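(* Let $p\geq3$ be prime and $\alpha,\beta\in\mathbb{Z}_p$. Suppose that (i) $\langle-\beta\rangle_p<\langle-\alpha\rangle_p$; (ii) $2\langle-\alpha\rangle_p+\langle-\beta\rangle_p\leq p-1\leq3\langle-\alpha\rangle_p+2\langle-\beta\rangle_p$; (iii) $\langle-\alpha\rangle_p/\alpha=\langle-\beta\rangle_p/\beta$; (iv) $(\alpha-\beta+1)_{p-1}$ is not divisible by $p^2$. Let $M=2\langle-\alpha\rangle_p+\langle-\beta\rangle_p$. Then $$\sum_{k=0}^{M}\frac{(\alpha)_k^4(1+\frac12\alpha)_k(\beta)_k(1-\alpha-\beta)_k}{(k!)^4(\frac12\alpha)_k(\alpha-\beta+1)_k(2\alpha+\beta)_k}\equiv-\frac{\alpha}{\alpha-\beta}\cdot\frac{\Gamma_p(1-\alpha-\beta)^3\Gamma_p(1-2\alpha)\Gamma_p(1+\alpha-\beta)}{\Gamma_p(1-\beta)^3\Gamma_p(1-\alpha)^3\Gamma_p(1+\alpha)\Gamma_p(1-2\alpha-\beta)}\pmod{p^5}.$$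
   Context: $(x)_k=x(x+1)\cdots(x+k-1)$, $(x)_0=1$. $\langle x\rangle_p\in\{0,\ldots,p-1\}$ is the least nonnegative residue of $x\in\mathbb{Z}_p$ mod $p$. $\Gamma_p$ is Morita's $p$-adic Gamma function: $\Gamma_p(0)=1$, $\Gamma_p(n)=(-1)^n\prod_{1\leq k<n,\ p\nmid k}k$ for integers $n\geq1$, extended continuously to $\mathbb{Z}_p$. *)

(* Defs.v *)
From HB Require Import structures.
From mathcomp Require Import all_boot all_order all_algebra.
From mathcomp Require Import boolp classical_sets.

Set Implicit Arguments.
Unset Strict Implicit.
Unset Printing Implicit Defensive.

Import GRing.Theory.
Local Open Scope ring_scope.

Notation "x %:F" := (FracField.tofrac x) : ring_scope.

(* Z_p as the inverse limit of the Z/p^n: component n is the representative in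
   {0, .., p^n - 1} of x modulo p^n (the equation below forces x n < p^n).  The
   proof that p is prime is a parameter of the type so that the integral domain
   structure can be inferred from the type. *)
Record padic_int (p : nat) (p_pr : prime p) := PadicInt {
  padic_seq :> nat -> nat;
  padic_coh : forall n, (padic_seq n.+1 %% p ^ n)%N = padic_seq n }.

Section PadicInt.
Context (p : nat) (p_pr : prime p).
Local Notation Zp := (padic_int p_pr).
Implicit Types x y z : Zp.

HB.instance Definition _ := gen_eqMixin Zp.
HB.instance Definition _ := gen_choiceMixin Zp.

Lemma padic_eqP x y : (forall n, x n = y n) -> x = y.
Proof.
case: x y => [f Hf] [g Hg] /= /funext eq_fg; case: _ / eq_fg Hg => Hg.
by congr PadicInt; apply: Prop_irrelevance.
Qed.

Lemma padic_mod x n : (x n %% p ^ n)%N = x n.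
Proof. by rewrite -(padic_coh x n) modn_mod. Qed.

Fact padic_of_coh (f : nat -> nat) :
    (forall n, f n.+1 = f n %[mod p ^ n])%N ->
  forall n, ((f n.+1 %% p ^ n.+1) %% p ^ n)%N = (f n %% p ^ n)%N.
Proof. by move=> Hf n; rewrite modn_dvdm ?Hf // dvdn_exp2l. Qed.

Fact padic_nat_coh (m n : nat) : (m = m %[mod p ^ n])%N. Proof. by []. Qed.
Fact padic_add_coh x y n : (x n.+1 + y n.+1 = x n + y n %[mod p ^ n])%N.
Proof. by rewrite -modnDm !padic_coh. Qed.
Fact padic_mul_coh x y n : (x n.+1 * y n.+1 = x n * y n %[mod p ^ n])%N.
Proof. by rewrite -modnMm !padic_coh. Qed.
Fact padic_opp_coh x n :
  (p ^ n.+1 - x n.+1 = p ^ n - x n %[mod p ^ n])%N.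
Proof.
have lex m : (x m <= p ^ m)%N.
  by rewrite -padic_mod ltnW // ltn_mod expn_gt0 prime_gt0.
apply/eqP; rewrite -(eqn_modDr (x n)) subnK // modnn.
rewrite -modnDmr -[x n]padic_coh modn_mod modnDmr subnK //.
by rewrite -/(dvdn _ _) dvdn_exp2l.
Qed.

Definition padic_nat (m : nat) : Zp :=
  PadicInt p_pr (padic_of_coh (padic_nat_coh m)).
Definition padic_add x y : Zp := PadicInt p_pr (padic_of_coh (padic_add_coh x y)).
Definition padic_mul x y : Zp := PadicInt p_pr (padic_of_coh (padic_mul_coh x y)).
Definition padic_opp x : Zp := PadicInt p_pr (padic_of_coh (padic_opp_coh x)).

Fact padic_addA : associative padic_add.
Proof. by move=> x y z; apply: padic_eqP => n /=; rewrite modnDml modnDmr addnA. Qed.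
Fact padic_addC : commutative padic_add.
Proof. by move=> x y; apply: padic_eqP => n /=; rewrite addnC. Qed.
Fact padic_add0 : left_id (padic_nat 0) padic_add.
Proof. by move=> x; apply: padic_eqP => n /=; rewrite mod0n add0n padic_mod. Qed.
Fact padic_addN : left_inverse (padic_nat 0) padic_opp padic_add.
Proof.
move=> x; apply: padic_eqP => n /=; rewrite modnDml subnK ?modnn ?mod0n //.
by rewrite -padic_mod ltnW // ltn_mod expn_gt0 prime_gt0.
Qed.
HB.instance Definition _ :=
  GRing.isZmodule.Build Zp padic_addA padic_addC padic_add0 padic_addN.

Fact padic_mulA : associative padic_mul.
Proof. by move=> x y z; apply: padic_eqP => n /=; rewrite modnMml modnMmr mulnA. Qed.
Fact padic_mulC : commutative padic_mul.
Proof. by move=> x y; apply: padic_eqP => n /=; rewrite mulnC. Qed.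
Fact padic_mul1 : left_id (padic_nat 1) padic_mul.
Proof. by move=> x; apply: padic_eqP => n /=; rewrite modnMml mul1n padic_mod. Qed.
Fact padic_mulD : left_distributive padic_mul padic_add.
Proof.
by move=> x y z; apply: padic_eqP => n /=; rewrite modnMml modnDm mulnDl.
Qed.
Fact padic_1neq0 : padic_nat 1 != padic_nat 0.
Proof.
apply/eqP => /(congr1 (fun x : Zp => x 1%N)) /=.
by rewrite mod0n modn_small // expn1 prime_gt1.
Qed.
HB.instance Definition _ := GRing.Zmodule_isComNzRing.Build Zp
  padic_mulA padic_mulC padic_mul1 padic_mulD padic_1neq0.

Lemma padic_natr (m n : nat) : (m%:R : Zp) n = (m %% p ^ n)%N.
Proof.
elim: m => [|m IHm] //.
by rewrite -addn1 natrD /= IHm modnDm.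
Qed.

Definition padic_unit : {pred Zp} := fun x => `[< exists y, y * x = 1 >].
Definition padic_inv x : Zp := xget x [set y | y * x = 1].

Fact padic_mulV : {in padic_unit, left_inverse 1 padic_inv *%R}.
Proof. by move=> x /asboolP[y Hy]; apply: (@xgetPex _ x [set y | y * x = 1]); exists y. Qed.
Fact padic_unitP x y : y * x = 1 -> padic_unit x.
Proof. by move=> yx; apply/asboolP; exists y. Qed.
Fact padic_inv_out : {in [predC padic_unit], padic_inv =1 id}.
Proof.
move=> x /negP nUx; apply: (@xgetPN _ x [set y | y * x = 1]) => y yx.
by apply: nUx; apply: padic_unitP yx.
Qed.
HB.instance Definition _ := GRing.ComNzRing_hasMulInverse.Build Zp
  padic_mulV padic_unitP padic_inv_out.

Fact padic_idomain x y : x * y = 0 -> (x == 0) || (y == 0).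
Proof.
move=> xy0; apply/norP => -[/eqP x0 /eqP y0].
have nz z : z <> 0 -> exists n, z n <> 0%N.
  move=> z0; apply: contrapT => zn; apply: z0; apply: padic_eqP => n.
  rewrite (padic_natr 0) mod0n; apply: contrapT => zn0; apply: zn; by exists n.
have coh z n m : (z (n + m)%N %% p ^ n)%N = z n.
  elim: m => [|m IHm]; first by rewrite addn0 padic_mod.
  rewrite addnS -IHm -[z (n + m)%N]padic_coh [in RHS]modn_dvdm //.
  by rewrite dvdn_exp2l // leq_addr.
have [n xn] := nz _ x0; have [m ym] := nz _ y0.
have /(congr1 (fun z : Zp => z (n + m)%N)) := xy0.
rewrite (padic_natr 0) mod0n /=.
move: (coh x n m) (coh y m n); rewrite (addnC m n).
move: (x (n + m)%N) (y (n + m)%N) => X Y EX EY /eqP; rewrite -/(dvdn _ _) => dXY.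
have X0 : (0 < X)%N by case: (X) EX => // EX; case: xn; rewrite -EX mod0n.
have Y0 : (0 < Y)%N by case: (Y) EY => // EY; case: ym; rewrite -EY mod0n.
have lX : (logn p X < n)%N.
  by rewrite ltnNge -pfactor_dvdn //; apply/negP => /eqP dX; apply: xn; rewrite -EX.
have lY : (logn p Y < m)%N.
  by rewrite ltnNge -pfactor_dvdn //; apply/negP => /eqP dY; apply: ym; rewrite -EY.
move: dXY; rewrite pfactor_dvdn ?muln_gt0 ?X0 // lognM //.
by rewrite leqNgt -addnS leq_add // ltnW.
Qed.
HB.instance Definition _ := GRing.ComUnitRing_isIntegral.Build Zp padic_idomain.

Definition padic_residue x : nat := x 1%N.

Lemma padic_residueP x (r : nat) :
  (r < p)%N -> (exists z, x = r%:R + p%:R * z) -> padic_residue x = r.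
Proof.
move=> ltrp [z ->]; rewrite /padic_residue /= !padic_natr expn1 modnn mul0n.
by rewrite mod0n addn0 modn_mod modn_small.
Qed.

Definition padic_dvd (N : nat) x : Prop := exists z, x = p%:R ^+ N * z.

(* Congruence modulo p^N Z_p between elements of Q_p. *)
Definition padic_eqmod (N : nat) (u v : {fraction Zp}) : Prop :=
  exists z : Zp, u - v = (p%:R ^+ N * z)%:F.

Definition padic_continuous (G : Zp -> Zp) : Prop :=
  forall x N, exists M, forall y,
    padic_dvd M (y - x) -> padic_dvd N (G y - G x).

Definition is_morita_gamma (G : Zp -> Zp) : Prop :=
  padic_continuous G /\
  forall n : nat,
    G n%:R = (-1) ^+ n * \prod_(1 <= k < n | ~~ (p %| k)%N) k%:R.

(* Since nat is dense in Z_p, at most one function satisfies is_morita_gamma;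
   Morita's theorem is that one exists, so the default value is not used. *)
Definition morita_gamma : Zp -> Zp := xget (fun=> 1) is_morita_gamma.

End PadicInt.

Definition pochhammer (R : nzRingType) (x : R) (k : nat) : R :=
  \prod_(i < k) (x + i%:R).

Notation "''Z_[' pr ]" := (padic_int pr) (format "''Z_[' pr ]") : type_scope.
Notation "''Q_[' pr ]" := {fraction padic_int pr}
  (format "''Q_[' pr ]") : type_scope.

(* Main.v *)
(** Put a = <-alpha>, b = <-beta>, X0 = X1 = X2 = X3 = alpha + a, Y = beta + b.
The sum is the value at this point of a very well-poised 7F6 with the parameters
-a + X0; -a + X1, -a + X2, -a + X3, -b + Y and a fifth one fixed by Dougall's
2-balance.  Let D be (X0 - Y)(X0 - a) times the difference between this truncated sum
and a product R of Pochhammer symbols interpolating all of Dougall's products.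
Where X1, X2, X3 or Y is 0 the sum terminates and Dougall's formula gives D = 0;
where X0 = 0 both terms vanish, the sum because it is antisymmetric under
k -> a - k.  Hence D = X0 X1 X2 X3 Y H with H constant modulo p on
(p Z_p)^5.  At (3p, p, p, p, 4p) the fifth parameter is -(p - 1 - a - b), so
Dougall's formula applies once more and gives D = 0 modulo p^6; therefore H is
divisible by p everywhere, and D by p^6.  Hypothesis (iv) says that X0 - Y is p
times a unit, so the sum is R modulo p^5.  Both this computation and the
comparison of R with the Gamma quotient rest on the fact that the third
difference of log (pm + 1)...(pm + p - 1) in m vanishes modulo p^5. *)

From HB Require Import structures.
Require Import Defs.
From mathcomp Require Import all_boot all_order all_algebra all_field.
From mathcomp Require Import boolp classical_sets.
From mathcomp Require Import ring zify.

Set Implicit Arguments.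
Unset Strict Implicit.
Unset Printing Implicit Defensive.

Import GRing.Theory.
Local Open Scope ring_scope.

(** * Congruences between p-adic integers *)

(** The factor X0 - Y clears the only obstruction to integrality: (1 + alpha - beta)_k contains it
    as soon as k >= a - b, and up to k = 2a + b all other denominators are units, by the upper bound
    in (ii). The defect is thus a rational function with unit denominators on (p Z_p)^5. This class
    is closed under division by a coordinate on whose hyperplane the function vanishes, so factoring
    out the five coordinates costs no power of p. Dougall's formula, however, needs nonzero
    denominators, which fails when X0 = 0 or X0 = Y; vanishing is therefore proved at nearby points
    and carried over by congruences. The factorization alone would give the sum modulo p^4 only; the
    missing p is a statement about the constant H mod p, so one further evaluation suffices. There
    the lower bound in (ii) says p - 1 - a - b <= 2a + b, so the truncated sum contains the whole
    terminating series. The two products then differ by (1 + z)_(p-1) at z = 0, p, 2p, 3p with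
    exponents -1, 3, -3, 1 up to sign: a third difference. Hypothesis (iii) reads aY = bX with X =
    alpha + a, Y = beta + b, and produces the factor alpha / (alpha - beta). *)

Section PadicBasics.
Context (p : nat) (p_pr : prime p).
Local Notation Zp := (padic_int p_pr).
Implicit Types x y z : Zp.

Lemma padic_lt x n : (x n < p ^ n)%N.
Proof. by rewrite -padic_mod ltn_mod expn_gt0 prime_gt0. Qed.

Lemma padic_addE x y n : (x + y) n = ((x n + y n) %% p ^ n)%N.
Proof. by []. Qed.

Lemma padic_mulE x y n : (x * y) n = ((x n * y n) %% p ^ n)%N.
Proof. by []. Qed.

Lemma padic_comp_le x n m : (n <= m)%N -> (x m %% p ^ n)%N = x n.
Proof.
move=> /subnK <-; elim: (m - n)%N => [|k IHk]; first by rewrite padic_mod.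
by rewrite addSn -IHk -[in RHS](padic_coh x) modn_dvdm // dvdn_exp2l // leq_addl.
Qed.

Lemma padic_comp0 n : (0 : Zp) n = 0%N.
Proof. by rewrite (padic_natr p_pr 0) mod0n. Qed.

Lemma padic_at0 x : x 0%N = 0%N.
Proof. by rewrite -padic_mod modn1. Qed.

Lemma padic_dvdE N x : padic_dvd N x <-> x N = 0%N.
Proof.
split=> [[z ->]|x0].
  by rewrite padic_mulE -natrX padic_natr modnn mul0n mod0n.
have dvdx n : (p ^ N %| x (N + n)%N)%N.
  by apply/eqP; rewrite padic_comp_le ?leq_addr.
(* Component n of the quotient by p^N is read off component N + n of [x], since the division costs N
   digits. *)
have zP n : (((x (N + n.+1) %/ p ^ N) %% p ^ n.+1) %% p ^ n
             = (x (N + n) %/ p ^ N) %% p ^ n)%N.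
  apply: (@padic_of_coh p (fun n => x (N + n)%N %/ p ^ N)%N) => m.
  have pN_gt0 : (0 < p ^ N)%N by rewrite expn_gt0 prime_gt0.
  have E := padic_coh x (N + m); rewrite -addnS in E.
  have Ed : x (N + m.+1)%N
      = (x (N + m.+1)%N %/ p ^ (N + m) * p ^ m * p ^ N + x (N + m)%N)%N.
    by rewrite -mulnA -expnD [(m + N)%N]addnC -E -divn_eq.
  by rewrite Ed divnMDl // modnMDl.
exists (PadicInt p_pr zP); apply: padic_eqP => n.
rewrite padic_mulE -natrX padic_natr /= modnMml modnMmr mulnC divnK ?dvdx //.
by rewrite padic_comp_le ?leq_addl.
Qed.

Lemma padic_congrP N x y : padic_dvd N (x - y) <-> x N = y N.
Proof.
rewrite padic_dvdE; split=> [h|h].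
  by rewrite -[x](subrK y) padic_addE h add0n padic_mod.
have -> : (x - y) N = (y - y) N by rewrite !padic_addE h.
by rewrite subrr padic_comp0.
Qed.

Lemma padic_congrD N x x' y y' : x N = x' N -> y N = y' N -> (x + y) N = (x' + y') N.
Proof. by rewrite !padic_addE => -> ->. Qed.

Lemma padic_congrM N x x' y y' : x N = x' N -> y N = y' N -> (x * y) N = (x' * y') N.
Proof. by rewrite !padic_mulE => -> ->. Qed.

Lemma padic_congrN N x y : x N = y N -> (- x) N = (- y) N.
Proof. by move=> h; rewrite /= h. Qed.

Lemma padic_congrX N x y k : x N = y N -> (x ^+ k) N = (y ^+ k) N.
Proof. by move=> h; elim: k => // k IHk; rewrite !exprS; apply: padic_congrM. Qed.

Lemma padic_congr_prod N (I : Type) (r : seq I) (P : pred I) (F F' : I -> Zp) :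
  (forall i, P i -> F i N = F' i N) ->
  (\prod_(i <- r | P i) F i) N = (\prod_(i <- r | P i) F' i) N.
Proof.
by move=> h; elim/big_rec2: _ => // i x y Pi; apply: padic_congrM; apply: h.
Qed.

Lemma padic_congr_nat N x : x N = ((x N)%:R : Zp) N.
Proof. by rewrite padic_natr padic_mod. Qed.

Lemma padic_congr_dvd N x y z : x = y + p%:R ^+ N * z -> x N = y N.
Proof. by move=> ->; apply/padic_congrP; exists z; rewrite addrC addKr. Qed.

Lemma padic_congr_le N K x y : (K <= N)%N -> x N = y N -> x K = y K.
Proof. by move=> leKN E; rewrite -!(padic_comp_le _ leKN) E. Qed.

Lemma padic_natr_inj : injective (fun n : nat => n%:R : Zp).
Proof.
move=> m n /= /(congr1 (fun z : Zp => z (m + n)%N)); rewrite !padic_natr.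
have lt_exp k : (k <= m + n)%N -> (k < p ^ (m + n))%N.
  by move=> /leq_ltn_trans; apply; rewrite ltn_expl ?prime_gt1.
by rewrite !modn_small ?lt_exp ?leq_addr ?leq_addl.
Qed.

Lemma padic_natr_eq0 n : ((n%:R : Zp) == 0) = (n == 0%N).
Proof.
by apply/eqP/eqP => [|->] // h; apply: padic_natr_inj.
Qed.

Lemma padic_p_neq0 : (p%:R : Zp) != 0.
Proof. by rewrite padic_natr_eq0 -lt0n prime_gt0. Qed.

Lemma padic_dvd_mulXl N K x : padic_dvd (K + N) (p%:R ^+ K * x) -> padic_dvd N x.
Proof.
move=> [z]; rewrite exprD -mulrA => /mulfI h; exists z; apply: h.
by rewrite expf_neq0 ?padic_p_neq0.
Qed.

Lemma padic_unitE x : (x \is a GRing.unit) = (x 1%N != 0%N).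
Proof.
apply/idP/idP => [ux|x1].
  apply/eqP => x1; have := congr1 (fun z : Zp => z 1%N) (mulVr ux).
  by rewrite padic_mulE x1 muln0 mod0n (padic_natr p_pr 1) modn_small // expn1 prime_gt1.
have cop n : coprime (x n) (p ^ n).
  case: n => [|n]; first by rewrite coprimen1.
  rewrite coprime_sym coprime_pexpl // prime_coprime //; apply/negP => /eqP d.
  by move: x1; rewrite -(@padic_comp_le x 1 n.+1) // expn1 d.
(* A Bezout coefficient inverts [x n] modulo p^n; uniqueness of inverses modulo p^n makes these
   coefficients coherent. *)
pose f n := (egcdn (x n) (p ^ n)).1.
have fP n : (f n * x n = 1 %[mod p ^ n])%N.
  have [x0|xn] := posnP (x n).
    by have := cop n; rewrite x0 /coprime gcd0n => /eqP ->; rewrite !modn1.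
  rewrite /f; case: (egcdnP (p ^ n) xn) => u v /= -> _.
  by rewrite (eqP (cop n)) modnMDl.
have fc n : (f n.+1 = f n %[mod p ^ n])%N.
  have E : (f n.+1 * x n = f n * x n %[mod p ^ n])%N.
    rewrite fP -[x n]padic_coh modnMmr.
    by rewrite -(@modn_dvdm (p ^ n.+1)) ?dvdn_exp2l // fP modn_dvdm ?dvdn_exp2l.
  have -> : (f n.+1 = f n.+1 * (f n * x n) %[mod p ^ n])%N.
    by rewrite -[in RHS]modnMmr fP modnMmr muln1.
  have -> : (f n = f n * (f n * x n) %[mod p ^ n])%N.
    by rewrite -[in RHS]modnMmr fP modnMmr muln1.
  by rewrite mulnCA -modnMmr E modnMmr.
apply/asboolP; exists (PadicInt p_pr (padic_of_coh fc)); apply: padic_eqP => n.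
by rewrite padic_mulE (padic_natr p_pr 1) /= modnMml fP.
Qed.

Lemma padic_unit_congr x y : x 1%N = y 1%N -> (x \is a GRing.unit) = (y \is a GRing.unit).
Proof. by rewrite !padic_unitE => ->. Qed.

Lemma padic_unit_nat n : ((n%:R : Zp) \is a GRing.unit) = ~~ (p %| n)%N.
Proof. by rewrite padic_unitE padic_natr expn1. Qed.

Lemma padic_dvd_nonunit x : padic_dvd 1 x <-> x \isn't a GRing.unit.
Proof. by rewrite padic_dvdE padic_unitE negbK; split=> /eqP. Qed.

Lemma padic_dvdMl N x y : padic_dvd N y -> padic_dvd N (x * y).
Proof. by move=> [z ->]; exists (x * z); rewrite mulrCA. Qed.

Lemma padic_dvdMr N x y : padic_dvd N x -> padic_dvd N (x * y).
Proof. by rewrite mulrC; apply: padic_dvdMl. Qed.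

Lemma padic_dvd_unitMl N x y : x \is a GRing.unit -> padic_dvd N (x * y) -> padic_dvd N y.
Proof. by move=> ux /(padic_dvdMl x^-1); rewrite mulKr. Qed.

Lemma padic_dvdD N x y : padic_dvd N x -> padic_dvd N y -> padic_dvd N (x + y).
Proof. by move=> [z ->] [t ->]; exists (z + t); rewrite mulrDr. Qed.

Lemma padic_dvdN N x : padic_dvd N x -> padic_dvd N (- x).
Proof. by move=> [z ->]; exists (- z); rewrite mulrN. Qed.

Lemma padic_dvd0 N : padic_dvd N (0 : Zp).
Proof. by exists 0; rewrite mulr0. Qed.

Lemma padic_dvdM N K x y : padic_dvd N x -> padic_dvd K y -> padic_dvd (N + K) (x * y).
Proof. by move=> [z ->] [t ->]; exists (z * t); rewrite exprD mulrACA. Qed.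

Lemma padic_congrV N x y : (0 < N)%N -> x \is a GRing.unit -> x N = y N ->
  x^-1 N = y^-1 N.
Proof.
move=> N0 ux h; have uy : y \is a GRing.unit.
  by rewrite -(padic_unit_congr (padic_congr_le N0 h)).
move/esym/padic_congrP: h => /(padic_dvdMl (x^-1 * y^-1)) h; apply/padic_congrP.
rewrite (_ : _ - _ = x^-1 * y^-1 * (y - x)) // mulrBr -mulrA mulVr // mulr1.
by rewrite mulrAC mulVr // mul1r.
Qed.

(** Serves to move a point off X0 = 0 and X0 = Y without changing it modulo p^N. Among the three
    distinct points [f 0], [f 1], [f 2] one avoids both forbidden values. *)
Lemma padic_avoid N x y z : exists x', [/\ x' N = x N, x' != y & x' != z].
Proof.
pose f i : Zp := x + p%:R ^+ (N + i).
have fN i : f i N = x N.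
  by apply: (@padic_congr_dvd _ _ _ (p%:R ^+ i)); rewrite -exprD.
have f_inj : injective f.
  move=> i j /addrI; rewrite -!natrX => /padic_natr_inj /eqP.
  by rewrite eqn_exp2l ?prime_gt1 // eqn_add2l => /eqP.
have [fy0|] := eqVneq (f 0%N) y; last first.
  move=> fy0; have [fz0|fz0] := eqVneq (f 0%N) z; last by exists (f 0%N).
  have [fy1|fy1] := eqVneq (f 1%N) y.
    by exists (f 2); split; rewrite // -?fy1 -?fz0 (inj_eq f_inj).
  by exists (f 1%N); split; rewrite // -fz0 (inj_eq f_inj).
have [fz1|fz1] := eqVneq (f 1%N) z.
  by exists (f 2); split; rewrite // -?fy0 -?fz1 (inj_eq f_inj).
by exists (f 1%N); split; rewrite // -fy0 (inj_eq f_inj).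
Qed.

End PadicBasics.

(** * Pochhammer symbols and Dougall's summation formula *)

Section Pochhammer.
Variable R : comNzRingType.
Implicit Types x y : R.

Lemma pochhammer0 x : pochhammer x 0 = 1.
Proof. by rewrite /pochhammer big_ord0. Qed.

Lemma pochhammerS x k : pochhammer x k.+1 = pochhammer x k * (x + k%:R).
Proof. by rewrite /pochhammer big_ord_recr. Qed.

Lemma pochhammerSl x k : pochhammer x k.+1 = x * pochhammer (x + 1) k.
Proof.
rewrite /pochhammer big_ord_recl addr0; congr (_ * _); apply: eq_bigr => i _.
by rewrite lift0 -addrA -natr1 [1 + _]addrC.
Qed.

Lemma pochhammerD x m n :
  pochhammer x (m + n) = pochhammer x m * pochhammer (x + m%:R) n.
Proof.
rewrite /pochhammer big_split_ord; congr (_ * _).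
by apply: eq_bigr => i _; rewrite natrD addrA.
Qed.

Lemma pochhammer_rev x n :
  pochhammer x n = (-1) ^+ n * pochhammer (1 - n%:R - x) n.
Proof.
rewrite /pochhammer (reindex_inj rev_ord_inj) /=.
rewrite -[n in (-1) ^+ n]card_ord -prodr_const -big_split /=.
apply: eq_bigr => i _; rewrite mulN1r natrB // -natr1; ring.
Qed.
End Pochhammer.

Lemma rmorph_pochhammer (R S : comNzRingType) (f : {rmorphism R -> S}) x k :
  f (pochhammer x k) = pochhammer (f x) k.
Proof. by rewrite rmorph_prod; apply: eq_bigr => i _; rewrite rmorphD rmorph_nat. Qed.

Lemma pochhammer_neq0 (F : idomainType) (x : F) k :
  (forall j, (j < k)%N -> x + j%:R != 0) -> pochhammer x k != 0.
Proof. by move=> h; apply/prodf_neq0 => i _; apply: h. Qed.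

Lemma pochhammer_eq0 (R : comNzRingType) n k :
  (n < k)%N -> pochhammer (- n%:R : R) k = 0.
Proof.
by move=> h; rewrite /pochhammer (bigD1 (Ordinal h)) //= addNr mul0r.
Qed.

(** * Dougall's summation formula by a Wilf-Zeilberger induction *)

Section Dougall.
Variable F : fieldType.
Implicit Types A b c d e f : F.

(* The well-poised summand with its very-well-poised factor 1 + 2k/A replaced
   by A + 2k, which makes sense for A = 0. *)
Definition dougall_term A b c d e f k : F :=
  (A + 2%:R * k%:R) *
  (pochhammer A k * pochhammer b k * pochhammer c k * pochhammer d k
   * pochhammer e k * pochhammer f k)
  / ((k`!)%:R * pochhammer (1 + A - b) k * pochhammer (1 + A - c) k
     * pochhammer (1 + A - d) k * pochhammer (1 + A - e) k * pochhammer (1 + A - f) k).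


(* With N = 1 + A + n, rho is the ratio of Dougall's products for n + 1 and n,
   and the identity says that F(n + 1, k) - rho F(n, k) = G(k + 1) - G(k), where
   F(n, k) is the summand and G the rational multiple of F given by the right
   hand side (a Wilf-Zeilberger pair). *)
Lemma dougall_cert A b c d e n k :
  e = 1 + 2%:R * A - b - c - d + n ->
  let N := 1 + A + n in
  let rho := (N * (N - b - c) * (N - b - d) * (N - c - d))
     / ((N - b) * (N - c) * (N - d) * (N - b - c - d)) in
  let C := N * (e + n + 1) / (e * (N - b) * (N - c) * (N - d) * (N - b - c - d)) in
  [/\ e != 0, (N - b) != 0, N - c != 0, N - d != 0 & N - b - c - d != 0] ->
  [/\ N + k != 0, n + 1 - k != 0, (1 + A - b + k) != 0, (1 + A - c + k) != 0
    & (1 + A - d + k) != 0] -> A - e + k != 0 ->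
  (A + 2%:R * k) * ((e + k) / e * ((A - e + k) / (A - e))
     * ((n + 1) / (n + 1 - k)) * (N / (N + k)) - rho)
   = - C * (k * (k + A - b) * (k + A - c) * (k + A - d) * (k + A - e) / (n + 1 - k))
   - C * (A + k) * (b + k) * (c + k) * (d + k) * (e + k) / (N + k).
Proof.
move=> -> N rho C [? ? ? ? ?] [? ? ? ? ?] ?; rewrite /rho /C /N.
have De : A - (1 + 2%:R * A - b - c - d + n) != 0.
  by rewrite (_ : _ - _ = - (N - b - c - d)) ?oppr_eq0 // /N; ring.
by field; do ?[apply/andP; split].
Qed.

Lemma pochhammer_shift (x : F) k : x != 0 ->
  pochhammer (x + 1) k = pochhammer x k * (x + k%:R) / x.
Proof. by move=> x0; rewrite -pochhammerS pochhammerSl mulrC mulKf. Qed.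

(** Collects what the certificate divides by in the steps below n, so that the condition passes to
    smaller n. The bound 2n in the first clause comes from N + k with N = A + n and k <= n at the
    last step; A itself may vanish. *)
Definition dougall_regular A b c d n :=
  [/\ forall j, (0 < j <= 2 * n)%N -> A + j%:R != 0,
      forall j, (j < n)%N -> 1 + 2%:R * A - b - c - d + j%:R != 0,
      forall j, (j < n)%N -> 1 + A - b - c - d + j%:R != 0
    & forall j, (j < n)%N ->
        [/\ 1 + A - b + j%:R != 0, 1 + A - c + j%:R != 0 & 1 + A - d + j%:R != 0]].

Section DougallInduction.
Variables (A b c d : F).

Hypothesis char0 : forall j, (j.+1)%:R != 0 :> F.

Section Step.
Variable n : nat.
Hypothesis hyp : dougall_regular A b c d n.+1.

Let n' : F := n%:R.
Let N := 1 + A + n'.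
Let e := 1 + 2%:R * A - b - c - d + n'.
Let rho := (N * (N - b - c) * (N - b - d) * (N - c - d))
     / ((N - b) * (N - c) * (N - d) * (N - b - c - d)).
Let C := N * (e + n' + 1) / (e * (N - b) * (N - c) * (N - d) * (N - b - c - d)).

Let u k := (pochhammer A k * pochhammer b k * pochhammer c k * pochhammer d k
   * pochhammer e k * pochhammer (- n') k)
  / ((k`!)%:R * pochhammer (1 + A - b) k * pochhammer (1 + A - c) k
     * pochhammer (1 + A - d) k * pochhammer (1 + A - e) k * pochhammer N k).
(** [- g k] is the certificate G(k + 1), rewritten in terms of [u k]: at k = n the original form is
    0 / 0, because [u n.+1] and the denominator n' + 1 - (k + 1) both vanish. *)
Let g k := C * u k * (A + k%:R) * (b + k%:R) * (c + k%:R) * (d + k%:R) * (e + k%:R)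
     / (N + k%:R).

Let e_neq0 : e != 0. Proof. by case: hyp => _ h _ _; apply: h. Qed.
Let Nb_neq0 : [/\ N - b != 0, N - c != 0, N - d != 0 & N - b - c - d != 0].
Proof.
case: hyp => _ _ h1 /(_ n (ltnSn n)) [h2 h3 h4]; split.
- by rewrite (_ : N - b = 1 + A - b + n') //; rewrite /N; ring.
- by rewrite (_ : N - c = 1 + A - c + n') //; rewrite /N; ring.
- by rewrite (_ : N - d = 1 + A - d + n') //; rewrite /N; ring.
rewrite (_ : _ - _ = 1 + A - b - c - d + n'); first exact: h1.
by rewrite /N; ring.
Qed.
Let Nk_neq0 k : (k <= n.+1)%N -> N + k%:R != 0.
Proof.
move=> lekn; case: hyp => h _ _ _; rewrite (_ : _ + _ = A + (n + k).+1%:R).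
  by apply: h; lia.
by rewrite /N /n' -natr1 natrD; ring.
Qed.
Let nk_neq0 k : (k <= n)%N -> n' + 1 - k%:R != 0.
Proof.
by move=> lekn; rewrite /n' natr1 -natrB ?leqW // subSn.
Qed.
Let Ae_neq0 k : (k <= n)%N -> A - e + k%:R != 0.
Proof.
move=> lekn; case: hyp => _ _ h _.
rewrite (_ : _ + _ = - (1 + A - b - c - d + (n - k)%:R)).
  by rewrite oppr_eq0; apply: h; lia.
by rewrite /e natrB // /n'; ring.
Qed.

Let poch_neq0 k : (k <= n.+1)%N ->
  [/\ pochhammer (1 + A - b) k != 0, pochhammer (1 + A - c) k != 0,
      pochhammer (1 + A - d) k != 0 & pochhammer N k != 0].
Proof.
move=> lek; case: hyp => _ _ _ h; split; apply: pochhammer_neq0 => j ltj.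
- by case: (h j (leq_trans ltj lek)).
- by case: (h j (leq_trans ltj lek)).
- by case: (h j (leq_trans ltj lek)).
by apply: Nk_neq0; rewrite ltnW // (leq_trans ltj).
Qed.
Let pe_neq0 k : (k <= n)%N -> pochhammer (1 + A - e) k != 0.
Proof.
move=> lek; apply: pochhammer_neq0 => j ltj.
rewrite (_ : 1 + A - e + j%:R = A - e + j.+1%:R) ?Ae_neq0 ?(leq_trans ltj) //.
by rewrite -natr1; ring.
Qed.
Let fact_neq0 k : (k`!)%:R != 0 :> F.
Proof. by move: (fact_gt0 k); case: (k`!) => // j _; apply: char0. Qed.

Let T n k := dougall_term A b c d (1 + 2%:R * A - b - c - d + n%:R) (- n%:R) k.

Let T_u k : T n k = (A + 2%:R * k%:R) * u k.
Proof. by rewrite /T /dougall_term opprK -mulrA. Qed.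

Let eS : 1 + 2%:R * A - b - c - d + n.+1%:R = e + 1.
Proof. by rewrite /e /n' -(natr1 n) addrA. Qed.
Let NS : 1 + A - - n.+1%:R = N + 1.
Proof. by rewrite opprK -(natr1 n) addrA. Qed.

Let TS k : (k <= n)%N ->
  T n.+1 k = (A + 2%:R * k%:R) * u k * ((e + k%:R) / e * ((A - e + k%:R) / (A - e))
    * ((n' + 1) / (n' + 1 - k%:R)) * (N / (N + k%:R))).
Proof.
move=> lek; rewrite /T /dougall_term eS NS -mulrA.
have [P1 P2 P3 P4] := poch_neq0 (leqW lek).
have N0 : N != 0 by rewrite -[N]addr0; apply: (@Nk_neq0 0).
have AE0 : A - e != 0 by rewrite -[A - e]addr0; apply: (@Ae_neq0 0).
have Nk := Nk_neq0 (leqW lek); have AEk := Ae_neq0 lek; have nk := nk_neq0 lek.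
have Pe := pe_neq0 lek; have fk := fact_neq0 k.
have n0 : n' + 1 != 0 by rewrite natr1.
rewrite (pochhammer_shift k e_neq0) (pochhammer_shift k N0).
have -> : pochhammer (- n.+1%:R) k = pochhammer (- n') k * (n' + 1) / (n' + 1 - k%:R).
  have -> : - n' = - n.+1%:R + 1 :> F by rewrite -(natr1 n) /n'; ring.
  rewrite pochhammer_shift ?oppr_eq0 // -(natr1 n) -/n'.
  have nk' : - (n' + 1) + k%:R != 0 by rewrite -oppr_eq0 opprD opprK.
  by field; rewrite -/n' nk oppr_eq0 n0.
have -> : 1 + A - (e + 1) = A - e by ring.
move: Pe; have -> : 1 + A - e = A - e + 1 by ring.
rewrite (pochhammer_shift k AE0) !mulf_eq0 invr_eq0 !negb_or -andbA => /and3P[Pe _ _].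
rewrite /u (_ : 1 + A - e = A - e + 1); last by ring.
rewrite (pochhammer_shift k AE0).
have e0 := e_neq0.
move: (pochhammer (- n') k) (pochhammer e k) (pochhammer (1 + A - b) k) P1
 (pochhammer (1 + A - c) k) P2 (pochhammer (1 + A - d) k) P3 (pochhammer N k) P4
 (pochhammer (A - e) k) Pe => q1 q2 q3 h3 q4 h4 q5 h5 q6 h6 q7 h7.
by field; do ?[apply/andP; split].
Qed.

Let uS k : (k < n)%N ->
  u k.+1 * (k.+1%:R * (k.+1%:R + A - b) * (k.+1%:R + A - c) * (k.+1%:R + A - d)
    * (k.+1%:R + A - e) / (n' + 1 - k.+1%:R))
  = - (u k * (A + k%:R) * (b + k%:R) * (c + k%:R) * (d + k%:R) * (e + k%:R) / (N + k%:R)).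
Proof.
move=> ltk; have [P1 P2 P3 P4] := poch_neq0 (leqW ltk).
have Pe := pe_neq0 ltk; have nk := nk_neq0 ltk.
move: P1 P2 P3 P4 Pe (char0 k) nk; rewrite /u factS natrM !pochhammerS -natr1.
rewrite !mulf_eq0 !negb_or => /andP[P1 Q1] /andP[P2 Q2] /andP[P3 Q3] /andP[P4 Q4].
move=> /andP[P5 Q5] k0 nk; have fk := fact_neq0 k.
move: (pochhammer (- n') k) (pochhammer e k) (pochhammer (1 + A - b) k) P1
 (pochhammer (1 + A - c) k) P2 (pochhammer (1 + A - d) k) P3 (pochhammer N k) P4
 (pochhammer (1 + A - e) k) P5 => q1 q2 q3 h3 q4 h4 q5 h5 q6 h6 q7 h7.
have Q6 : n' - k%:R != 0 by move: nk; rewrite opprD addrACA subrr addr0.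
field.
by rewrite -/n'; do ?[apply/andP; split].
Qed.

Let cert k : (k <= n)%N -> T n.+1 k - rho * T n k
  = - C * (u k * (k%:R * (k%:R + A - b) * (k%:R + A - c) * (k%:R + A - d)
       * (k%:R + A - e) / (n' + 1 - k%:R))) - g k.
Proof.
move=> lek; rewrite TS // T_u.
have [B1 B2 B3 B4] := Nb_neq0; have [P1 P2 P3 _] := @poch_neq0 k.+1 lek.
move: P1 P2 P3; rewrite !pochhammerS !mulf_eq0 !negb_or.
move=> /andP[_ P1] /andP[_ P2] /andP[_ P3].
have := @dougall_cert A b c d e n' k%:R erefl.
move=> /(_ (And5 e_neq0 B1 B2 B3 B4)) /(_ (And5 (Nk_neq0 (leqW lek)) (nk_neq0 lek) P1 P2 P3)).
move=> /(_ (Ae_neq0 lek)); rewrite -/N -/rho -/C => E.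
rewrite /g; transitivity (u k * ((A + 2 * k%:R) *
    ((e + k%:R) / e * ((A - e + k%:R) / (A - e)) * ((n' + 1) / (n' + 1 - k%:R)) *
     (N / (N + k%:R)) - rho))); first by ring.
by rewrite E; ring.
Qed.

Let telescope m : (m <= n)%N -> \sum_(k < m.+1) (T n.+1 k - rho * T n k) = - g m.
Proof.
elim: m => [_|m IHm ltm]; first by rewrite big_ord1 cert // !(mul0r, mulr0) sub0r.
rewrite big_ord_recr /=.
rewrite (IHm (ltnW ltm)).
rewrite (cert ltm).
rewrite (uS ltm).
rewrite mulrNN.
rewrite addrA.
rewrite (_ : C * _ = g m).
  by rewrite addNr sub0r.
rewrite /g.
by rewrite !mulrA.
Qed.

(** The sum for n + 1 has one term more than the sum for n; that term cancels the boundary value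
    [- g n] left by telescoping. *)
Let last_term : T n.+1 n.+1 = g n.
Proof.
have [B1 B2 B3 B4] := Nb_neq0; have [P1 P2 P3 P4] := @poch_neq0 n.+1 (leqnn _).
have Pe := @pe_neq0 n (leqnn _); have fk := fact_neq0 n.
have N0 : N != 0 by rewrite -[N]addr0; apply: (@Nk_neq0 0).
have AE0 : A - e != 0 by rewrite -[A - e]addr0; apply: (@Ae_neq0 0).
have AEn := @Ae_neq0 n (leqnn _); have Nn := @Nk_neq0 n.+1 (leqnn _).
have e0 := e_neq0.
rewrite /T /dougall_term eS NS.
have -> : 1 + A - (e + 1) = A - e by ring.
rewrite (pochhammer_shift _ e_neq0) (pochhammer_shift _ N0).
rewrite (pochhammerSl (- n.+1%:R)) (pochhammerSl (A - e)).
have -> : - n.+1%:R + 1 = - n' :> F by rewrite -(natr1 n) /n'; ring.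
have -> : A - e + 1 = 1 + A - e by ring.
rewrite /g /u; move: P1 P2 P3 P4 Nn fk (char0 n).
rewrite factS natrM !pochhammerS -(natr1 n) -/n'.
rewrite !mulf_eq0 !negb_or => /andP[P1 Q1] /andP[P2 Q2] /andP[P3 Q3] /andP[P4 Q4] Nn fk n0.
have EA : A + 2%:R * (n' + 1) = N + (n' + 1) by rewrite /N; ring.
have EB : N - b - c - d = - (A - e) by rewrite /N /e; ring.
have [E1 E2 E3] : [/\ N - b = 1 + A - b + n', N - c = 1 + A - c + n' & N - d = 1 + A - d + n'].
  by split; rewrite /N; ring.
rewrite /C EA EB E1 E2 E3.
move: (pochhammer (- n') n) (pochhammer e n) (pochhammer (1 + A - b) n) P1
 (pochhammer (1 + A - c) n) P2 (pochhammer (1 + A - d) n) P3 (pochhammer N n) P4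
 (pochhammer (1 + A - e) n) Pe => q1 q2 q3 h3 q4 h4 q5 h5 q6 h6 q7 h7.
move: (A - e) AE0 => Ae Ae0.
move: N N0 Nn Q4 => N' N0 Nn Q4.
field.
by rewrite -/n' oppr_eq0; do ?[apply/andP; split].
Qed.

Lemma dougall_step : \sum_(k < n.+2) T n.+1 k = rho * \sum_(k < n.+1) T n k.
Proof.
rewrite big_ord_recr /= last_term mulr_sumr; apply/eqP; rewrite -subr_eq0 addrAC.
by rewrite -sumrB telescope // addNr.
Qed.
End Step.

Lemma dougall n : dougall_regular A b c d n ->
  \sum_(k < n.+1) dougall_term A b c d (1 + 2%:R * A - b - c - d + n%:R) (- n%:R) k
  = A * (pochhammer (1 + A) n * pochhammer (1 + A - b - c) n
         * pochhammer (1 + A - b - d) n * pochhammer (1 + A - c - d) n)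
    / (pochhammer (1 + A - b) n * pochhammer (1 + A - c) n * pochhammer (1 + A - d) n
       * pochhammer (1 + A - b - c - d) n).
Proof.
elim: n => [_|n IHn hyp].
  by rewrite big_ord1 /dougall_term fact0 !pochhammer0 mulr0 addr0 !mulr1.
rewrite (dougall_step hyp) IHn; last first.
  case: hyp => h1 h2 h3 h4; split=> j lej; [apply: h1|apply: h2|apply: h3|apply: h4]; lia.
case: hyp => _ _ h3 h4.
have [E1 E2 E3] := h4 _ (ltnSn n); have E4 := h3 _ (ltnSn n).
have P1 : pochhammer (1 + A - b) n != 0.
  by apply: pochhammer_neq0 => j ltj; case: (h4 j (leqW ltj)).
have P2 : pochhammer (1 + A - c) n != 0.
  by apply: pochhammer_neq0 => j ltj; case: (h4 j (leqW ltj)).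
have P3 : pochhammer (1 + A - d) n != 0.
  by apply: pochhammer_neq0 => j ltj; case: (h4 j (leqW ltj)).
have P4 : pochhammer (1 + A - b - c - d) n != 0.
  by apply: pochhammer_neq0 => j ltj; apply: h3; apply: leqW.
rewrite !pochhammerS.
move: P1 P2 P3 P4 E1 E2 E3 E4.
move: (pochhammer (1 + A - b) n) (pochhammer (1 + A - c) n) (pochhammer (1 + A - d) n)
  (pochhammer (1 + A - b - c - d) n) => q1 q2 q3 q4.
rewrite !(addrAC _ A) !(addrAC _ n%:R) => P1 P2 P3 P4 E1 E2 E3 E4.
field.
by do ?[apply/andP; split].
Qed.
End DougallInduction.

(** The form in which Dougall's formula is applied: the terminating parameter sits in the first
    slot, and the sum may run past n because (-n)_k then contains the factor 0. *)
Lemma dougall_truncated A c d e f n M :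
    (forall j, (j.+1)%:R != 0 :> F) -> (n <= M)%N ->
    f = 1 + 2%:R * A - c - d - e + n%:R -> dougall_regular A c d e n ->
  \sum_(k < M.+1) dougall_term A (- n%:R) c d e f k
  = A * (pochhammer (1 + A) n * pochhammer (1 + A - c - d) n
         * pochhammer (1 + A - c - e) n * pochhammer (1 + A - d - e) n)
    / (pochhammer (1 + A - c) n * pochhammer (1 + A - d) n * pochhammer (1 + A - e) n
       * pochhammer (1 + A - c - d - e) n).
Proof.
move=> char0 lenM -> hyp; rewrite -(dougall char0 hyp).
rewrite (eq_bigr (fun k : 'I_M.+1 => dougall_term A c d e
  (1 + 2%:R * A - c - d - e + n%:R) (- n%:R) k)) => [|k _]; last first.
  by rewrite /dougall_term; congr (_ * _ / _); ring.
rewrite -!(big_mkord predT) /= (big_cat_nat (leq0n n.+1)) ?ltnS //=.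
rewrite [X in _ + X]big_nat_cond [X in _ + X]big1 ?addr0 // => k /andP[/andP[ltnk _] _].
by rewrite /dougall_term (pochhammer_eq0 _ ltnk) !(mulr0, mul0r).
Qed.
End Dougall.

(** * Divisibility of functions vanishing on coordinate hyperplanes *)

Section Admissible.
Context (p : nat) (p_pr : prime p).
Local Notation Zp := (padic_int p_pr).
Implicit Types (v w : nat -> Zp) (f g h : (nat -> Zp) -> Zp).

Definition in_polydisc v := forall i, padic_dvd 1 (v i).

(** Integral rational functions whose denominators are units at every point of the polydisc.
    Generating them inductively gives difference quotients and congruences by structural
    induction. *)
Inductive admissible : ((nat -> Zp) -> Zp) -> Prop :=
| adm_const c : admissible (fun=> c)
| adm_coord i : admissible (fun v => v i)
| adm_add f g : admissible f -> admissible g -> admissible (fun v => f v + g v)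
| adm_mul f g : admissible f -> admissible g -> admissible (fun v => f v * g v)
| adm_inv f : admissible f -> (forall v, in_polydisc v -> f v \is a GRing.unit) ->
    admissible (fun v => (f v)^-1).

Definition zero_at i v : nat -> Zp := fun j => if j == i then 0 else v j.

Lemma zero_at_polydisc i v : in_polydisc v -> in_polydisc (zero_at i v).
Proof. by move=> hv j; rewrite /zero_at; case: eqP => // _; apply: padic_dvd0. Qed.

Lemma adm_zero_at i f : admissible f -> admissible (fun v => f (zero_at i v)).
Proof.
elim=> {f} [c|j|f g _ IHf _ IHg|f g _ IHf _ IHg|f _ IHf uf].
- exact: adm_const.
- rewrite /zero_at; case: eqP => _; [exact: adm_const | exact: adm_coord].
- exact: adm_add.
- exact: adm_mul.
by apply: adm_inv => // v hv; apply/uf/zero_at_polydisc.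
Qed.

(** The difference quotient in coordinate i obeys a product rule f'g + f(0)g' and, for inverses, -f'
    / (f f(0)), where (0) means coordinate i set to 0; the denominator f(0) stays a unit because
    [zero_at] preserves the polydisc. *)
Lemma adm_sub_zero_at i f : admissible f ->
  exists2 g, admissible g &
    forall v, in_polydisc v -> f v - f (zero_at i v) = v i * g v.
Proof.
elim=> {f} [c|j|f g af [f' af' Ef] ag [g' ag' Eg]|f g af [f' af' Ef] ag [g' ag' Eg]|].
- by exists (fun=> 0) => [|v _]; [apply: adm_const | rewrite subrr mulr0].
- have [->|neq_ji] := eqVneq j i.
    exists (fun=> 1) => [|v _]; first exact: adm_const.
    by rewrite /zero_at eqxx subr0 mulr1.
  exists (fun=> 0) => [|v _]; first exact: adm_const.
  by rewrite /zero_at (negPf neq_ji) subrr mulr0.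
- exists (fun v => f' v + g' v) => [|v hv]; first exact: adm_add.
  by rewrite mulrDr -Ef // -Eg // opprD addrACA.
- exists (fun v => f' v * g v + f (zero_at i v) * g' v) => [|v hv].
    by apply: adm_add; apply: adm_mul => //; apply: adm_zero_at.
  by rewrite mulrDr mulrA (mulrCA (v i)) -Ef // -Eg //; ring.
move=> f af [f' af' Ef] uf.
exists (fun v => f' v * (- 1 * ((f v)^-1 * (f (zero_at i v))^-1))) => [|v hv].
  do ![apply: adm_mul => //]; first exact: adm_const; apply: adm_inv => //.
    exact: adm_zero_at.
  by move=> v hv; apply/uf/zero_at_polydisc.
have u1 := uf _ hv; have u2 := uf _ (zero_at_polydisc i hv).
rewrite mulrA -Ef // mulN1r mulrN -mulNr opprB mulrBl; congr (_ - _).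
  by rewrite mulrCA mulrV ?mulr1.
by rewrite mulrA mulrV ?mul1r.
Qed.

(** For N = 1 this makes every admissible function constant modulo p on the polydisc; for large N it
    allows a point to be replaced by a generic one nearby. *)
Lemma adm_congr N f v w : (0 < N)%N -> admissible f -> in_polydisc v -> in_polydisc w ->
  (forall i, v i N = w i N) -> f v N = f w N.
Proof.
move=> N0 af hv hw E; elim: af => {f} [c|j|f g _ IHf _ IHg|f g _ IHf _ IHg|f _ IHf uf] //.
- exact: padic_congrD.
- exact: padic_congrM.
by apply: padic_congrV => //; apply: uf.
Qed.

Lemma adm_sum (I : Type) (r : seq I) (F : I -> (nat -> Zp) -> Zp) :
  (forall i, admissible (F i)) -> admissible (fun v => \sum_(i <- r) F i v).
Proof.
move=> aF; elim: r => [|i r IHr].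
  rewrite (_ : (fun v => _) = fun=> 0); first exact: adm_const.
  by apply/funext => v; rewrite big_nil.
rewrite (_ : (fun v => _) = fun v => F i v + \sum_(j <- r) F j v).
  exact: adm_add.
by apply/funext => v; rewrite big_cons.
Qed.

Lemma adm_prod (I : Type) (r : seq I) (P : pred I) (F : I -> (nat -> Zp) -> Zp) :
  (forall i, admissible (F i)) -> admissible (fun v => \prod_(i <- r | P i) F i v).
Proof.
move=> aF; elim: r => [|i r IHr].
  rewrite (_ : (fun v => _) = fun=> 1); first exact: adm_const.
  by apply/funext => v; rewrite big_nil.
rewrite (_ : (fun v => _) = fun v => (if P i then F i v else 1) * \prod_(j <- r | P j) F j v).
  by apply: adm_mul => //; case: (P i) => //; apply: adm_const.
by apply/funext => v; rewrite big_cons; case: (P i); rewrite ?mul1r.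
Qed.

(** The quotient g by the first n coordinates need not be shown to vanish where coordinate n does,
    which would require cancelling coordinates that may be 0. It is enough that the product of the
    first n coordinates does not involve coordinate n: times g at [zero_at n v] it is f there, hence
    0. *)
Lemma adm_factor n f : admissible f ->
    (forall v i, in_polydisc v -> (i < n)%N -> v i = 0 -> f v = 0) ->
  exists2 g, admissible g &
    forall v, in_polydisc v -> f v = (\prod_(i < n) v i) * g v.
Proof.
move=> af; elim: n => [|n IHn] f0.
  by exists f => // v _; rewrite big_ord0 mul1r.
have [v i hv lti|g ag Eg] := IHn; first by apply: f0 => //; apply: leqW.
have [g' ag' Eg'] := adm_sub_zero_at n ag.
exists g' => // v hv; rewrite big_ord_recr /= -mulrA -Eg' // mulrBr -Eg //.
have z_prod : \prod_(i < n) v i = \prod_(i < n) zero_at n v i.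
  by apply: eq_bigr => i _; rewrite /zero_at ltn_eqF.
rewrite z_prod -Eg; last exact: zero_at_polydisc.
by rewrite (f0 _ n (zero_at_polydisc n hv)) ?subr0 // /zero_at eqxx.
Qed.

End Admissible.

(** * Morita's Gamma function *)

Section FirstOrder.
Variable R : comNzRingType.

(** The linear coefficient [Y] is chosen before [c], so that one [Y] serves all blocks in the
    generalized Wilson theorem below. *)
Lemma prod_first_order (g e : nat -> R) m :
  exists Y, forall c, exists z,
    \prod_(i < m) (g i + c * e i) = \prod_(i < m) g i + c * Y + c ^+ 2 * z.
Proof.
elim: m => [|m [Y IHm]].
  by exists 0 => c; exists 0; rewrite !big_ord0 !mulr0 !addr0.
exists (Y * g m + \prod_(i < m) g i * e m) => c; have [z E] := IHm c.
exists (Y * e m + z * (g m + c * e m)); rewrite !big_ord_recr /= E; ring.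
Qed.

Lemma prod_arith_first_order (x c : R) m :
  exists z, \prod_(i < m) (x + c * i%:R)
    = x ^+ m + c * x ^+ m.-1 * 'C(m, 2)%:R + c ^+ 2 * z.
Proof.
elim: m => [|m [z IHm]]; first by exists 0; rewrite big_ord0 !mulr0 !addr0.
exists (x ^+ m.-1 * 'C(m, 2)%:R * m%:R + z * (x + c * m%:R)).
rewrite big_ord_recr /= IHm binS bin1 natrD.
by case: m {IHm} => [|m] /=; rewrite ?(@bin_small 0) // ?exprS; ring.
Qed.
End FirstOrder.

Section MoritaGamma.
Context (p : nat) (p_pr : prime p) (p_odd : odd p).
Local Notation Zp := (padic_int p_pr).
Implicit Types x y z : Zp.

Definition prime_to_p_part (k : nat) : Zp := if (p %| k)%N then 1 else k%:R.
Local Notation f := prime_to_p_part.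

Lemma prime_to_p_unit k : f k \is a GRing.unit.
Proof. by rewrite /f; case: ifPn => [_|]; rewrite ?unitr1 // padic_unit_nat. Qed.

Definition nat_gamma (n : nat) : Zp := (-1) ^+ n * \prod_(i < n) f i.

Lemma nat_gammaE n :
  (-1) ^+ n * \prod_(1 <= k < n | ~~ (p %| k)%N) k%:R = nat_gamma n.
Proof.
congr (_ * _); case: n => [|n]; first by rewrite big_ord0 big_geq.
rewrite big_ord_recl /f dvdn0 mul1r big_mkcond big_add1 big_mkord /=.
by apply: eq_bigr => i _; case: (_ %| _)%N.
Qed.

Lemma prime_to_p_shift N k j : (0 < N)%N ->
  f (k + j * p ^ N) = f k + p%:R ^+ N * (if (p %| k)%N then 0 else j%:R).
Proof.
move=> N0; rewrite /f dvdn_addl; last by rewrite dvdn_mull // dvdn_exp.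
by case: ifP => _; rewrite ?mulr0 ?addr0 // natrD natrM natrX mulrC.
Qed.

(** In x^p - y^p = (x - y) S the cofactor S is congruent to p x^(p-1), hence to 0, modulo p. *)
Lemma padic_congr_exp_p N x y : (0 < N)%N -> x N = y N -> (x ^+ p) N.+1 = (y ^+ p) N.+1.
Proof.
move=> N0 E; apply/padic_congrP; rewrite subrXX -addn1.
apply: padic_dvdM; first exact/padic_congrP.
apply/padic_dvdE; have E1 := padic_congr_le N0 E.
have -> : (\sum_(i < p) x ^+ (p.-1 - i) * y ^+ i) 1%N = (\sum_(i < p) x ^+ p.-1) 1%N.
  elim/big_rec2: _ => // i s t _ IH; apply: padic_congrD => //.
  rewrite -[in RHS](@subnK i p.-1) ?exprD; last by have := ltn_ord i; lia.
  by apply: padic_congrM => //; apply/esym/padic_congrX.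
rewrite sumr_const card_ord -[_ *+ _]mulr_natl; apply/padic_dvdE.
by exists (x ^+ p.-1); rewrite expr1.
Qed.

(** Wilson's theorem modulo p^N, by induction. Cut p^(N+1) consecutive integers into p blocks of
    length p^N = t: block j has product X + t Y j modulo p^(N+1). The product over j is X^p up to
    the term t Y X^(p-1) C(p, 2), which vanishes since p divides C(p, 2), and X^p is congruent to
    (-1)^p because raising to the power p gains one digit. *)
Lemma prod_prime_to_p N : (0 < N)%N -> (\prod_(i < p ^ N) f i) N = (-1 : Zp) N.
Proof.
elim: N => // -[|N] IHN _.
  apply/padic_congrP; rewrite opprK.
  have -> : \prod_(i < p ^ 1) f i = (p.-1)`!%:R.
    have aux m : (m < p)%N -> \prod_(i < m.+1) f i = m`!%:R.
      elim: m => [|m IHm] ltm; first by rewrite big_ord1 /f dvdn0.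
      rewrite big_ord_recr /= (IHm (ltnW ltm)) factS natrM [RHS]mulrC; congr (_ * _).
      rewrite /f ifF //.
      by apply/negP => /dvdn_leq -/(_ isT); rewrite leqNgt ltm.
    have := @aux p.-1; rewrite expn1 prednK ?prime_gt0 //; exact.
  have := Wilson (prime_gt1 p_pr); rewrite p_pr => /esym/dvdnP[k E].
  by exists k%:R; rewrite natr1 E natrM mulrC.
set t : Zp := p%:R ^+ N.+1; set X := \prod_(i < p ^ N.+1) f i in IHN *.
pose e k : Zp := if (p %| k)%N then 0 else 1.
have [Y EY] := prod_first_order f e (p ^ N.+1).
have t2 z : padic_dvd N.+2 (t ^+ 2 * z).
  rewrite mulrC; apply/padic_dvdMl; exists (p%:R ^+ N).
  by rewrite /t -exprM -exprD; congr (_ ^+ _); lia.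
have block j : (\prod_(i < p ^ N.+1) f (i + j * p ^ N.+1)%N) N.+2 = (X + t * Y * j%:R) N.+2.
  have [z Ez] := EY (t * j%:R); apply/padic_congrP.
  under eq_bigr => i _ do rewrite prime_to_p_shift //.
  rewrite (eq_bigr (fun i : 'I_(p ^ N.+1) => f i + t * j%:R * e i)); last first.
    by move=> i _; rewrite -mulrA /e /t; case: ifP => _; rewrite ?mulr1 ?mulr0.
  rewrite Ez (_ : _ - _ = t ^+ 2 * (j%:R ^+ 2 * z)); first exact: t2.
  by rewrite /X; ring.
have -> : \prod_(i < p ^ N.+2) f i
    = \prod_(j < p) \prod_(i < p ^ N.+1) f (i + j * p ^ N.+1)%N.
  rewrite expnS; move: (p ^ N.+1)%N => q.
  have aux m : \prod_(i < m * q) f i = \prod_(j < m) \prod_(i < q) f (i + j * q)%N.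
    elim: m => [|m IHm]; first by rewrite mul0n !big_ord0.
    rewrite big_ord_recr -IHm mulSn addnC big_split_ord /=; congr (_ * _).
    by apply: eq_bigr => i _; rewrite addnC.
  exact: aux.
have -> : (\prod_(j < p) \prod_(i < p ^ N.+1) f (i + j * p ^ N.+1)%N) N.+2
   = (\prod_(j < p) (X + t * Y * j%:R)) N.+2.
  exact: padic_congr_prod.
have [z ->] := prod_arith_first_order X (t * Y) p.
transitivity ((X ^+ p) N.+2); last first.
  by rewrite (padic_congr_exp_p _ (IHN _)) // -signr_odd p_odd expr1.
have /dvdnP[k ->] : (p %| 'C(p, 2))%N.
  by apply: prime_dvd_bin => //; case: (p) p_pr p_odd => [|[|[|]]].
apply/padic_congrP.
rewrite (_ : _ - _ = p%:R ^+ N.+2 * (Y * X ^+ p.-1 * k%:R) + t ^+ 2 * (Y ^+ 2 * z)); last first.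
  by rewrite natrM (exprS _ N.+1) -/t; ring.
by apply: padic_dvdD => //; exists (Y * X ^+ p.-1 * k%:R).
Qed.

(** Sliding the window by one replaces [f n] by the congruent unit f(n + p^N). *)
Lemma prod_prime_to_p_shift N n : (0 < N)%N ->
  (\prod_(i < p ^ N) f (i + n)%N) N = (-1 : Zp) N.
Proof.
move=> N0; elim: n => [|n IHn].
  by rewrite -[RHS](prod_prime_to_p N0); under eq_bigr do rewrite addn0.
apply/padic_congrP/(padic_dvd_unitMl (prime_to_p_unit n)).
rewrite mulrBr; apply/padic_congrP; rewrite -(padic_congrM (erefl (f n N)) IHn).
have -> : f n * \prod_(i < p ^ N) f (i + n.+1)%N = \prod_(i < (p ^ N).+1) f (i + n)%N.
  by rewrite big_ord_recl; congr (_ * _); apply: eq_bigr => i _; rewrite addnS.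
rewrite big_ord_recr mulrC; apply: padic_congrM => //=.
rewrite addnC -{1}[(p ^ N)%N]mul1n prime_to_p_shift //.
exact: (padic_congr_dvd erefl).
Qed.

(** The -1 of a full window cancels the sign (-1)^(p^N) = -1. This periodicity is what extends the
    function from the integers to Z_p. *)
Lemma nat_gamma_shift N n : (nat_gamma (n + p ^ N)) N = (nat_gamma n) N.
Proof.
case: N => [|N]; first by rewrite !padic_at0.
rewrite /nat_gamma big_split_ord exprD -mulrA.
apply: padic_congrM => //.
transitivity ((-1 * (\prod_(i < n) f i * -1) : Zp) N.+1); last by congr (padic_seq _ _); ring.
apply: padic_congrM.
  by rewrite -signr_odd oddX p_odd orbT expr1.
apply: padic_congrM => //.
rewrite (eq_bigr (fun i : 'I_(p ^ N.+1) => f (i + n)%N)) => [|i _ /=].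
  exact: prod_prime_to_p_shift.
by rewrite addnC.
Qed.

Lemma nat_gamma_mod N n m : (n = m %[mod p ^ N])%N -> (nat_gamma n) N = (nat_gamma m) N.
Proof.
have aux k r : nat_gamma (k * p ^ N + r) N = nat_gamma r N.
  by elim: k => // k IHk; rewrite mulSn -addnA addnC nat_gamma_shift.
by move=> E; rewrite (divn_eq n (p ^ N)) (divn_eq m (p ^ N)) E !aux.
Qed.

Lemma padic_gamma_coh x n :
  ((nat_gamma (x n.+1) n.+1) %% p ^ n)%N = nat_gamma (x n) n.
Proof. by rewrite padic_coh; apply: nat_gamma_mod; rewrite padic_coh padic_mod. Qed.

Lemma morita_gamma_exists : exists G : Zp -> Zp, is_morita_gamma G.
Proof.
exists (fun x => PadicInt p_pr (padic_gamma_coh x)); split=> [x N|n].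
  by exists N => y /padic_congrP E; apply/padic_congrP; rewrite /= E.
rewrite nat_gammaE; apply: padic_eqP => N /=.
by apply: nat_gamma_mod; rewrite padic_natr modn_mod.
Qed.

Local Notation G := (@morita_gamma p p_pr).

Lemma morita_gammaP : is_morita_gamma G.
Proof.
have [G0 hG0] := morita_gamma_exists.
by apply: (@xgetPex _ _ (@is_morita_gamma p p_pr)); exists G0.
Qed.

Lemma morita_gammaE x N : G x N = nat_gamma (x N) N.
Proof.
have [cG nG] := morita_gammaP; have [M hM] := cG x N.
pose K := maxn M N; have /hM/padic_congrP <- : padic_dvd M ((x K)%:R - x).
  by apply/padic_congrP/(@padic_congr_le _ _ K); rewrite ?leq_maxl // -padic_congr_nat.
rewrite nG nat_gammaE; apply: nat_gamma_mod.
by rewrite padic_comp_le ?leq_maxr // padic_mod.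
Qed.

Lemma nat_gammaS n : nat_gamma n.+1 = - f n * nat_gamma n.
Proof. by rewrite /nat_gamma big_ord_recr exprS /=; ring. Qed.

Lemma morita_gamma_congr N x y : x N = y N -> G x N = G y N.
Proof. by rewrite !morita_gammaE => ->. Qed.

Lemma morita_gamma_unit x : G x \is a GRing.unit.
Proof.
rewrite padic_unitE morita_gammaE -padic_unitE /nat_gamma unitrMl ?unitrX ?unitrN1 //.
by rewrite unitr_prod // => i _; apply: prime_to_p_unit.
Qed.

Lemma morita_gammaS x : G (x + 1) = - (if x \is a GRing.unit then x else 1) * G x.
Proof.
apply: padic_eqP => -[|N]; first by rewrite !padic_at0.
rewrite morita_gammaE.
have -> : nat_gamma ((x + 1)%R N.+1) N.+1 = nat_gamma (x N.+1).+1 N.+1.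
  by apply: nat_gamma_mod; rewrite padic_addE (padic_natr p_pr 1) modn_mod modnDmr addn1.
rewrite nat_gammaS; apply: padic_congrM; last by rewrite morita_gammaE.
apply: padic_congrN; rewrite /f padic_unitE.
have -> : (p %| x N.+1)%N = (x 1%N == 0%N).
  by rewrite -(@padic_comp_le _ _ x 1 N.+1) // expn1.
by case: eqP => // _; rewrite -padic_congr_nat.
Qed.

Lemma padic_unitD_nat z k : padic_dvd 1 z -> ~~ (p %| k)%N -> (k%:R + z) \is a GRing.unit.
Proof.
move=> [t ->] ndvd; rewrite (@padic_unit_congr _ _ _ k%:R) ?padic_unit_nat //.
exact: (padic_congr_dvd erefl).
Qed.

Lemma morita_gamma_nonunitS z : padic_dvd 1 z -> G (z + 1) = - G z.
Proof. by move=> /padic_dvd_nonunit/negPf uz; rewrite morita_gammaS uz mulN1r. Qed.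

(** Moves an argument to its part divisible by p. The step from z to z + 1 crosses a nonunit and
    contributes only a sign; the other m steps cross units and form the Pochhammer symbol. *)
Lemma morita_gamma_up z m : padic_dvd 1 z -> (m < p)%N ->
  G (1 + m%:R + z) = (-1) ^+ m.+1 * pochhammer (1 + z) m * G z.
Proof.
move=> z0; elim: m => [|m IHm] ltm.
  by rewrite addr0 addrC morita_gamma_nonunitS // pochhammer0 expr1 mulr1 mulN1r.
have -> : 1 + m.+1%:R + z = (1 + m%:R + z) + 1 by rewrite -(natr1 m); ring.
rewrite morita_gammaS ifT; last first.
  rewrite nat1r; apply: padic_unitD_nat => //.
  by apply/negP => /dvdn_leq -/(_ isT); rewrite leqNgt ltm.
rewrite (IHm (ltnW ltm)) pochhammerS !exprS; ring.
Qed.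

Lemma morita_gamma_down z m : padic_dvd 1 z -> (m < p)%N ->
  (-1) ^+ m * pochhammer (z - m%:R) m * G (z - m%:R) = G z.
Proof.
move=> z0; elim: m => [|m IHm] ltm; first by rewrite pochhammer0 subr0 !mul1r.
rewrite -(IHm (ltnW ltm)) pochhammerSl.
have -> : z - m%:R = z - m.+1%:R + 1 by rewrite -(natr1 m); ring.
rewrite (morita_gammaS (z - m.+1%:R)) ifT; last first.
  rewrite -unitrN opprB; apply: padic_unitD_nat; first exact: padic_dvdN.
  by apply/negP => /dvdn_leq -/(_ isT); rewrite leqNgt ltm.
rewrite exprS; ring.
Qed.

Lemma morita_gamma_addp z : padic_dvd 1 z ->
  G (z + p%:R) = - pochhammer (1 + z) p.-1 * G z.
Proof.
move=> z0; have p0 := prime_gt0 p_pr.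
have := @morita_gamma_up z p.-1 z0; rewrite prednK // leqnn => /(_ isT).
by rewrite nat1r (prednK p0) -signr_odd p_odd expr1 mulN1r addrC.
Qed.
End MoritaGamma.

(** * Third differences modulo p^5 *)

Section Reduction.
Context (p : nat) (p_pr : prime p).
Local Notation Zp := (padic_int p_pr).

Definition padic_red (x : Zp) : 'F_p := (x 1%N)%:R.

Lemma natr_mod_Fp (m : nat) : ((m %% p ^ 1)%:R : 'F_p) = m%:R.
Proof.
rewrite expn1 [in RHS](divn_eq m p) natrD natrM.
by rewrite (pcharf0 (pchar_Fp p_pr)) mulr0 add0r.
Qed.

Fact padic_red_additive : zmod_morphism padic_red.
Proof.
have addm x y : padic_red (x + y) = padic_red x + padic_red y.
  by rewrite /padic_red padic_addE natr_mod_Fp natrD.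
by move=> x y; apply/eqP; rewrite eq_sym subr_eq -addm subrK.
Qed.

Fact padic_red_multiplicative : monoid_morphism padic_red.
Proof.
split=> [|x y]; first by rewrite /padic_red (padic_natr p_pr 1) natr_mod_Fp.
by rewrite /padic_red padic_mulE natr_mod_Fp natrM.
Qed.

HB.instance Definition _ :=
  GRing.isZmodMorphism.Build Zp 'F_p padic_red padic_red_additive.
HB.instance Definition _ :=
  GRing.isMonoidMorphism.Build Zp 'F_p padic_red padic_red_multiplicative.

Lemma natr_Fp_eq0 m : ((m%:R : 'F_p) == 0) = (p %| m)%N.
Proof. by rewrite (dvdn_pcharf (pchar_Fp p_pr)). Qed.

Lemma padic_red_eq0 x : padic_red x = 0 -> padic_dvd 1 x.
Proof.
move/eqP; rewrite natr_Fp_eq0 padic_dvdE => d.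
by have := padic_lt x 1; rewrite expn1; case: (x 1%N) d => // k /dvdn_leq -/(_ isT); lia.
Qed.

Hypothesis p_odd : odd p.
Let n := p.-1./2.
Let n2 : p.-1 = (n + n)%N.
Proof. by rewrite addnn /n; move: (prime_gt0 p_pr) p_odd; lia. Qed.

(** Pairing the factors y + i and y + p - i of (1 + y)_(p-1) gives y(y + p) + i(p - i), so the whole
    product is this polynomial at y(y + p). *)
Definition half_poly : {poly Zp} :=
  \prod_(i < n) ('X - (- ((i.+1)%:R * (p - i.+1)%:R))%:P).

Lemma pochhammer_half_poly y :
  pochhammer (1 + y) p.-1 = half_poly.[y * (y + p%:R)].
Proof.
rewrite n2 pochhammerD [X in _ * X]pochhammer_rev horner_prod /pochhammer.
rewrite -[n in (-1) ^+ n]card_ord -prodr_const -!big_split /=.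
apply: eq_bigr => i _; rewrite hornerXsubC opprK.
have -> : p%:R = n%:R + n%:R + 1 :> Zp.
  by rewrite -natrD -n2 natr1 (prednK (prime_gt0 p_pr)).
have -> : (p - i.+1)%:R = n%:R + n%:R - i%:R :> Zp.
  have -> : (p - i.+1 = n + n - i)%N by rewrite -n2; move: (prime_gt0 p_pr); lia.
  by rewrite natrB ?natrD //; have := ltn_ord i; lia.
rewrite -natr1; ring.
Qed.

(** Modulo p the roots -i(p - i) become i^2, the n = (p - 1)/2 nonzero squares, which are the roots
    of X^n - 1. The difference of the two monic polynomials has degree below n and n distinct
    roots. *)
Lemma half_poly_red : map_poly padic_red half_poly = 'X^n - 1.
Proof.
have p0 := prime_gt0 p_pr.
have Em : map_poly padic_red half_poly = \prod_(i < n) ('X - ((i.+1)%:R ^+ 2 : 'F_p)%:P).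
  rewrite rmorph_prod; apply: eq_bigr => i _.
  rewrite rmorphB /= map_polyX map_polyC /= rmorphN rmorphM !rmorph_nat.
  rewrite natrB; last by have := ltn_ord i; lia.
  by rewrite (pcharf0 (pchar_Fp p_pr)) sub0r mulrN opprK expr2.
apply/eqP; rewrite -subr_eq0 Em; apply/eqP.
pose rs : seq 'F_p := [seq (i.+1)%:R ^+ 2 | i <- iota 0 n].
have Eprod : \prod_(i < n) ('X - ((i.+1)%:R ^+ 2 : 'F_p)%:P) = \prod_(z <- rs) ('X - z%:P).
  by rewrite big_map -[n in iota 0 n]subn0 -/(index_iota 0 n) big_mkord.
have urs : uniq rs.
  rewrite map_inj_in_uniq ?iota_uniq // => i j; rewrite !mem_iota => ltin ltjn /eqP.
  rewrite eqf_sqr -subr_eq0 -[X in _ || X]subr_eq0 opprK -natrD natr_Fp_eq0.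
  case/orP=> [|/dvdn_leq -/(_ isT)]; last by lia.
  wlog leij : i j ltin ltjn / (i <= j)%N => [IH|].
    by case: (leqP i j) => [/IH|/ltnW/IH h]; [apply | rewrite -oppr_eq0 opprB => /h ->].
  rewrite -oppr_eq0 opprB -natrB // subSS natr_Fp_eq0.
  by case: (posnP (j - i)) => [?|h /dvdn_leq -/(_ h)]; lia.
have szrs : size rs = n by rewrite size_map size_iota.
apply: (@roots_geq_poly_eq0 _ _ rs) => //.
  apply/allP => z zrs; rewrite rootE hornerD hornerN Eprod.
  have /eqP -> : root (\prod_(z <- rs) ('X - z%:P)) z by rewrite root_prod_XsubC.
  case/mapP: zrs => i; rewrite mem_iota => lti ->.
  rewrite hornerD hornerN hornerXn hornerC -exprM mul2n -addnn -n2.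
  have i0 : (i.+1%:R : 'F_p) != 0.
    by rewrite natr_Fp_eq0; apply/negP => /dvdn_leq -/(_ isT); lia.
  apply/eqP; rewrite sub0r opprB; apply/eqP; rewrite subr_eq0 eq_sym.
  apply/eqP/(mulfI i0); rewrite mulr1 -exprS (prednK p0).
  by have := expf_card (i.+1%:R : 'F_p); rewrite card_Fp.
rewrite szrs Eprod.
have n0 : (0 < n)%N by rewrite /n; move: p_odd (prime_gt1 p_pr); lia.
apply/leq_sizeP => j lenj; rewrite coefB coefB coefXn coef1 (gtn_eqF (leq_trans n0 lenj)).
have szp : size (\prod_(z <- rs) ('X - z%:P)) = n.+1 by rewrite size_prod_XsubC szrs.
move: lenj; rewrite leq_eqVlt => /orP[/eqP <-|ltnj].
  have /monicP := monic_prod_XsubC rs xpredT id.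
  by rewrite lead_coefE szp => -> /=; rewrite eqxx subr0 subrr.
by rewrite nth_default ?szp // (gtn_eqF ltnj) subrr subr0.
Qed.

Lemma half_poly_coef i : (0 < i < n)%N -> padic_dvd 1 half_poly`_i.
Proof.
move=> /andP[i0 ltin]; apply: padic_red_eq0.
rewrite -coef_map half_poly_red coefB coefXn coef1.
by rewrite (ltn_eqF ltin) (gtn_eqF i0) subrr.
Qed.
End Reduction.

Lemma horner_second_order (R : comNzRingType) (r : {poly R}) w :
  exists z, r.[w] = r`_0 + r`_1 * w + r`_2 * w ^+ 2 + w ^+ 3 * z.
Proof.
exists (drop_poly 3 r).[w]; rewrite -[in LHS](poly_take_drop 3 r) hornerD hornerM.
rewrite hornerXn mulrC; congr (_ + _).
rewrite (@horner_coef_wide _ 3) ?size_take_poly // !big_ord_recr big_ord0 /=.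
by rewrite !coef_take_poly /= add0r mulr1 expr1.
Qed.

Section ThirdDifference.
Context (p : nat) (p_pr : prime p) (p_gt6 : (6 < p)%N).
Local Notation Zp := (padic_int p_pr).
Implicit Types m h x y z : Zp.

Lemma prime_gt6_odd : odd p.
Proof. by have := even_prime p_pr; lia. Qed.
Local Notation p_odd := prime_gt6_odd.

Local Notation q y := (pochhammer (1 + y) p.-1 : Zp).

Lemma pochhammer_p_unit z : padic_dvd 1 z -> q z \is a GRing.unit.
Proof.
move=> z0; rewrite unitr_prod // => i _.
rewrite addrAC nat1r; apply: padic_unitD_nat => //.
by apply/negP => /dvdn_leq -/(_ isT); have := ltn_ord i; lia.
Qed.

(** At y = pm one has y(y + p) = p^2 m(m + 1). The coefficients of index 1 and 2 of [half_poly] are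
    divisible by p, so the terms of degree 1, 2, 3 carry p^3, p^5, p^6. Index 2 lies strictly below
    (p - 1)/2 exactly because p >= 7. *)
Lemma pochhammer_p_expand : exists c d, forall m,
  exists z, q (p%:R * m) = c + p%:R ^+ 3 * (d * (m * (m + 1))) + p%:R ^+ 5 * z.
Proof.
pose r := half_poly p_pr.
have r1 : padic_dvd 1 r`_1 by apply: half_poly_coef; [exact: p_odd|lia].
have r2 : padic_dvd 1 r`_2 by apply: half_poly_coef; [exact: p_odd|lia].
case: r1 r2 => d1 E1 [d2 E2]; exists r`_0, d1 => m.
have E := pochhammer_half_poly p_odd (p%:R * m).
have [z Ez] := horner_second_order r (p%:R * m * (p%:R * m + p%:R)).
exists (d2 * (m * (m + 1)) ^+ 2 + p%:R * (m * (m + 1)) ^+ 3 * z).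
by rewrite E Ez E1 E2; ring.
Qed.

(* The third difference of log q vanishes modulo p^5, since q is quadratic up
   to p^5 with linear and quadratic coefficients divisible by p^3. *)
Lemma pochhammer_p_third_difference m h :
  (q (p%:R * (m + h *+ 3)) * q (p%:R * (m + h)) ^+ 3) 5
  = (q (p%:R * (m + h *+ 2)) ^+ 3 * q (p%:R * m)) 5.
Proof.
have [c [d E]] := pochhammer_p_expand.
have {}E k : q (p%:R * k) 5 = (c + p%:R ^+ 3 * (d * (k * (k + 1)))) 5.
  by have [z ->] := E k; apply: (padic_congr_dvd erefl).
rewrite (padic_congrM (E _) (padic_congrX 3 (E _))).
rewrite (padic_congrM (padic_congrX 3 (E _)) (E _)).
pose s k := d * (k * (k + 1)).
pose t : Zp := p%:R ^+ 3.
(* [w al be] collects the part of (c + t al)(c + t be)^3 beyond first order, divided by t^2 = p^6.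
   The first order parts agree since the third difference of the quadratic [s] is 0. *)
pose w al be := c ^+ 2 * (3%:R * be ^+ 2 + 3%:R * al * be)
  + c * t * (be ^+ 3 + 3%:R * al * be ^+ 2) + t ^+ 2 * (al * be ^+ 3).
apply/padic_congrP; exists (p%:R * (w (s (m + h *+ 3)) (s (m + h))
  - w (s m) (s (m + h *+ 2)))).
rewrite /w /t /s; ring.
Qed.

Local Notation G := (@morita_gamma p p_pr).

(** Lowering an argument by p divides G by -(1 + z)_(p-1), so going from k to k + 1 changes the
    third difference of log G by a third difference of log (1 + z)_(p-1), which is 0 modulo p^5. *)
Lemma morita_gamma_third_difference m h (k : nat) :
  (G (p%:R * (m + h *+ 3 - k%:R)) * G (p%:R * (m + h - k%:R)) ^+ 3
   * (G (p%:R * (m + h *+ 2)) ^+ 3 * G (p%:R * m))) 5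
  = (G (p%:R * (m + h *+ 3)) * G (p%:R * (m + h)) ^+ 3
   * (G (p%:R * (m + h *+ 2 - k%:R)) ^+ 3 * G (p%:R * (m - k%:R)))) 5.
Proof.
have pd x : padic_dvd 1 (p%:R * x) by exists x; rewrite expr1.
elim: k => [|k IHk]; first by rewrite !subr0.
have step x : G (p%:R * (x - k%:R))
    = - q (p%:R * (x - k.+1%:R)) * G (p%:R * (x - k.+1%:R)).
  rewrite -(morita_gamma_addp p_odd) //; congr (G _).
  by rewrite -(natr1 k); ring.
have := pochhammer_p_third_difference (m - k.+1%:R) h.
rewrite (addrAC m _ (h *+ 3)) (addrAC m _ h) (addrAC m _ (h *+ 2)).
move: IHk; rewrite !step.
have := pochhammer_p_unit (pd (m + h - k.+1%:R)).
have := pochhammer_p_unit (pd (m + h *+ 3 - k.+1%:R)).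
set qa := pochhammer _ _; set qb := pochhammer _ _.
set qc := pochhammer (1 + p%:R * (m + h *+ 2 - _)) _.
set qd := pochhammer (1 + p%:R * (m - _)) _.
set ga := G _; set gb := G _; set C := G _ ^+ 3 * G _; set D := G _ * G _ ^+ 3.
set gc := G _; set gd := G _.
move=> ua ub IHk Eq; have uq : qa * qb ^+ 3 \is a GRing.unit by rewrite unitrMl ?unitrX.
apply/padic_congrP/(padic_dvd_unitMl uq); rewrite mulrBr; apply/padic_congrP.
transitivity ((qc ^+ 3 * qd * (D * (gc ^+ 3 * gd))) 5); last exact/esym/padic_congrM.
rewrite (_ : _ * _ = - qa * ga * (- qb * gb) ^+ 3 * C); last by ring.
by rewrite IHk; congr (padic_seq _ _); ring.
Qed.
End ThirdDifference.

(** * The deformed sum *)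

Section Deformation.
Variables (a b : nat).

Section Definitions.
Variable R : comUnitRingType.
Variables x0 x1 x2 x3 y : R.

Definition deform_main : R := x0 - a%:R.
Definition deform_par (x : R) : R := x - a%:R.
Definition deform_beta : R := y - b%:R.
(** With equal x0, x1, x2, x3 this is 1 - alpha - beta. For arguments divisible by p it is 1 + a + b
    modulo p, so 1 + A - [deform_last] is -(2a + b) modulo p: its Pochhammer symbol meets no
    multiple of p exactly up to the truncation 2a + b. *)
Definition deform_last : R :=
  1 + 2%:R * deform_main - deform_par x1 - deform_par x2 - deform_par x3 - deform_beta.

Local Notation A := deform_main.

(* A (x0 - y) times the k-th summand; the factor x0 - y of
   (1 + A - deform_beta)_k is cancelled. *)
Definition deform_term (k : nat) : R :=
  (if (k < a - b)%N then x0 - y else 1) * (A + 2%:R * k%:R) *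
  (pochhammer A k * pochhammer (deform_par x1) k * pochhammer (deform_par x2) k
   * pochhammer (deform_par x3) k * pochhammer deform_beta k * pochhammer deform_last k)
  / ((k`!)%:R * pochhammer (1 + A - deform_par x1) k * pochhammer (1 + A - deform_par x2) k
     * pochhammer (1 + A - deform_par x3) k
     * (\prod_(i < k | i != (a - b).-1 :> nat) (1 + A - deform_beta + i%:R))
     * pochhammer (1 + A - deform_last) k).

(* (x0 - y) A times the product of the Gamma(1 + A - sum S)^(+-1) over the
   subsets S of the four parameters deform_par x1, deform_par x2, deform_par x3 and
   deform_beta, with the exponent 1 when #|S| is odd; writing 1 + A - sum S = N + z,
   with z the corresponding combination of x0, ..., y, one keeps
   (1 + z)_(N - 1) instead of Gamma(N + z), and the common factor x0 - y of
   numerator and denominator is cancelled. *)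
Definition deform_value : R :=
  A * x0 * (pochhammer (1 + A) a.-1
   * (pochhammer (1 + x0 - x1 - x2 - y) (a + b) * pochhammer (1 + x0 - x1 - x3 - y) (a + b)
      * pochhammer (1 + x0 - x2 - x3 - y) (a + b)) * pochhammer (1 + x0 - x1 - x2 - x3) (a + a))
  / (pochhammer (1 + A - deform_beta) (a - b).-1
     * (pochhammer (1 + x0 - x1 - x2) a * pochhammer (1 + x0 - x1 - x3) a
        * pochhammer (1 + x0 - x2 - x3) a)
     * (pochhammer (1 + x0 - x1 - y) b * pochhammer (1 + x0 - x2 - y) b
        * pochhammer (1 + x0 - x3 - y) b)
     * pochhammer (1 + x0 - x1 - x2 - x3 - y) (a + a + b)).

Definition deform_defect : R := \sum_(k < (2 * a + b).+1) deform_term k - deform_value.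
End Definitions.

Lemma deform_last_swap12 (R : comUnitRingType) (x0 x1 x2 x3 y : R) :
  deform_last x0 x2 x1 x3 y = deform_last x0 x1 x2 x3 y.
Proof. rewrite /deform_last; ring. Qed.
Lemma deform_last_swap13 (R : comUnitRingType) (x0 x1 x2 x3 y : R) :
  deform_last x0 x3 x2 x1 y = deform_last x0 x1 x2 x3 y.
Proof. rewrite /deform_last; ring. Qed.

(** Symmetry in x1, x2, x3 reduces the hyperplanes x2 = 0 and x3 = 0 to x1 = 0. *)
Lemma deform_defect_swap12 (R : comUnitRingType) (x0 x1 x2 x3 y : R) :
  deform_defect x0 x2 x1 x3 y = deform_defect x0 x1 x2 x3 y.
Proof.
congr (_ - _).
  by apply: eq_bigr => k _; rewrite /deform_term deform_last_swap12; congr (_ * _ / _); ring.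
rewrite /deform_value !(addrAC _ (- x2) (- x1)); congr (_ * _ / _); ring.
Qed.
Lemma deform_defect_swap13 (R : comUnitRingType) (x0 x1 x2 x3 y : R) :
  deform_defect x0 x3 x2 x1 y = deform_defect x0 x1 x2 x3 y.
Proof.
congr (_ - _).
  by apply: eq_bigr => k _; rewrite /deform_term deform_last_swap13; congr (_ * _ / _); ring.
rewrite /deform_value.
have -> : 1 + x0 - x3 - x2 - x1 = 1 + x0 - x1 - x2 - x3 by ring.
rewrite (addrAC _ (- x3) (- x1)) (addrAC _ (- x3) (- x2)) (addrAC _ (- x2) (- x1)).
congr (_ * _ / _); ring.
Qed.

Lemma deform_term_dougall (F : fieldType) (x0 x1 x2 x3 y : F) k :
  \prod_(i < k | i != (a - b).-1 :> nat) (1 + deform_main x0 - deform_beta y + i%:R) != 0 ->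
  (b < a)%N -> x0 != y ->
  deform_term x0 x1 x2 x3 y k = (x0 - y) *
   dougall_term (deform_main x0) (deform_par x1) (deform_par x2) (deform_par x3)
     (deform_beta y) (deform_last x0 x1 x2 x3 y) k.
Proof.
move=> D0 ltba; rewrite -subr_eq0 => w0.
(* The factor of index a - b - 1 is x0 - y itself, and it is present exactly when k >= a - b. *)
have : pochhammer (1 + deform_main x0 - deform_beta y) k * (if (k < a - b)%N then x0 - y else 1)
  = (x0 - y) * \prod_(i < k | i != (a - b).-1 :> nat) (1 + deform_main x0 - deform_beta y + i%:R).
  case: ifPn => ltk.
    rewrite mulrC; congr (_ * _); apply: eq_bigl => i; apply/esym/eqP => Ei.
    by have := ltn_ord i; rewrite Ei; lia.
  have ltm : ((a - b).-1 < k)%N by lia.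
  rewrite mulr1 /pochhammer (bigD1 (Ordinal ltm)) //=; congr (_ * _).
  have -> : ((a - b).-1 = a - b.+1)%N by lia.
  by rewrite natrB // -natr1 /deform_main /deform_beta; ring.
rewrite /deform_term /dougall_term; move: D0.
set D := \prod_(i < k | _) _; set c := if _ then _ else _; move: D c (x0 - y) w0.
move=> D c w w0 D0; set P := pochhammer (1 + _ - deform_beta y) k => Ep.
have P0 : P != 0 by move: (mulf_neq0 w0 D0); rewrite -Ep mulf_eq0 negb_or => /andP[].
have -> : c = w * D * P^-1 by rewrite -Ep mulrAC mulfV ?mul1r.
set A := deform_main x0 + _; set N := pochhammer _ _ * _ * _ * _ * _ * _; set f := (k`!)%:R.
set p1 := pochhammer _ k; set p2 := pochhammer _ k; set p3 := pochhammer _ k.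
set p4 := pochhammer _ k.
transitivity (w * (A * N / (f * p1 * p2 * p3 * P * p4)) * (D / D)).
  by rewrite !invfM; ring.
by rewrite mulfV ?mulr1.
Qed.

(** * Integrality of the deformed sum and its image in the fraction field *)

Section Admissible.
Context (p : nat) (p_pr : prime p).
Local Notation Zp := (padic_int p_pr).
Hypotheses (b_gt0 : (0 < b)%N) (ltba : (b < a)%N) (le_p : (2 * a + b <= p.-1)%N).

Definition deform_defect_fun (v : nat -> Zp) : Zp := deform_defect (v 0%N) (v 1%N) (v 2) (v 3) (v 4).

Let p0 : (0 < p)%N. Proof. exact: prime_gt0. Qed.

Lemma padic_unit_pos (x z : Zp) c :
  x = c%:R + z -> padic_dvd 1 z -> (0 < c < p)%N -> x \is a GRing.unit.
Proof.
move=> -> z0 /andP[c0 ltc]; apply: padic_unitD_nat => //.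
by apply/negP => /dvdn_leq -/(_ c0); rewrite leqNgt ltc.
Qed.

Lemma padic_unit_neg (x z : Zp) c :
  x = z - c%:R -> padic_dvd 1 z -> (0 < c < p)%N -> x \is a GRing.unit.
Proof.
move=> -> z0 ltc; rewrite -unitrN.
by apply: (@padic_unit_pos _ (- z) c); [rewrite opprB | apply: padic_dvdN |].
Qed.

Lemma poch_unit_pos (x z : Zp) c k :
  x = c%:R + z -> padic_dvd 1 z -> (0 < c)%N -> (c + k <= p)%N ->
  pochhammer x k \is a GRing.unit.
Proof.
move=> -> z0 c0 lep; rewrite unitr_prod // => i _.
apply: (@padic_unit_pos _ z (c + i)) => //; first by rewrite natrD addrAC.
by have := ltn_ord i; lia.
Qed.

Lemma poch_unit_neg (x z : Zp) c k :
  x = z - c%:R -> padic_dvd 1 z -> (k <= c < p)%N ->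
  pochhammer x k \is a GRing.unit.
Proof.
move=> -> z0 lek; rewrite unitr_prod // => i _; have lti := ltn_ord i.
apply: (@padic_unit_neg _ z (c - i)) => //; last by lia.
by rewrite natrB; [ring | lia].
Qed.

Lemma fact_pochhammer (R : comNzRingType) k : (k`!)%:R = pochhammer (1 : R) k.
Proof.
elim: k => [|k IHk]; first by rewrite pochhammer0.
by rewrite factS natrM IHk pochhammerS mulrC nat1r.
Qed.

Section Units.
Variables x0 x1 x2 x3 y : Zp.
Hypotheses (d0 : padic_dvd 1 x0) (d1 : padic_dvd 1 x1) (d2 : padic_dvd 1 x2)
  (d3 : padic_dvd 1 x3) (dy : padic_dvd 1 y).

Lemma padic_dvdB N (x z : Zp) : padic_dvd N x -> padic_dvd N z -> padic_dvd N (x - z).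
Proof. by move=> ? ?; apply/padic_dvdD/padic_dvdN. Qed.

(** Since 2a + b < p, the factors have residues 1, ..., k, or -(2a + b), ..., -1 for the last
    parameter. In the symbol of [deform_beta] the residues run from 1 - (a - b) upwards and the one
    residue 0 belongs to the removed index. *)
Lemma deform_term_den_unit k : (k <= 2 * a + b)%N ->
  [/\ (k`!)%:R \is a @GRing.unit Zp,
      (forall x, padic_dvd 1 x ->
          pochhammer (1 + deform_main x0 - deform_par x) k \is a GRing.unit),
      \prod_(i < k | i != (a - b).-1 :> nat) (1 + deform_main x0 - deform_beta y + i%:R)
         \is a GRing.unit
    & pochhammer (1 + deform_main x0 - deform_last x0 x1 x2 x3 y) k \is a GRing.unit].
Proof.
move=> lek; split.
- rewrite fact_pochhammer; apply: (@poch_unit_pos _ 0 1) => //; last by lia.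
    by rewrite addr0.
  exact: padic_dvd0.
- move=> x dx; apply: (@poch_unit_pos _ (x0 - x) 1) => //; last by lia.
    by rewrite /deform_main /deform_par; ring.
  exact: padic_dvdB.
- rewrite unitr_prod // => i neq; have lti := ltn_ord i.
  have [ltm|ltm|eqm] := ltngtP i (a - b).-1; last by rewrite eqm eqxx in neq.
    apply: (@padic_unit_neg _ (x0 - y) ((a - b).-1 - i)); [|exact: padic_dvdB|lia].
    have -> : ((a - b).-1 - i = a - (b + i.+1))%N by lia.
    by rewrite /deform_main /deform_beta natrB ?natrD -?natr1; [ring|lia].
  apply: (@padic_unit_pos _ (x0 - y) (i - (a - b).-1)); [|exact: padic_dvdB|lia].
  have -> : (i - (a - b).-1 = b + i.+1 - a)%N by lia.
  by rewrite /deform_main /deform_beta natrB ?natrD -?natr1; [ring|lia].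
apply: (@poch_unit_neg _ (x1 + x2 + x3 + y - x0) (2 * a + b)); last by lia.
  by rewrite /deform_main /deform_last /deform_main /deform_par /deform_beta natrD natrM; ring.
by apply: padic_dvdB => //; do ![apply: padic_dvdD => //].
Qed.

Lemma poch_1z_unit (z : Zp) k : padic_dvd 1 z -> (k <= 2 * a + b)%N ->
  pochhammer (1 + z) k \is a GRing.unit.
Proof. by move=> dz lek; apply: (@poch_unit_pos _ z 1) => //; lia. Qed.

Lemma deform_value_den_unit :
  pochhammer (1 + deform_main x0 - deform_beta y) (a - b).-1 \is a GRing.unit.
Proof.
apply: (@poch_unit_neg _ (x0 - y) (a - b).-1); [|exact: padic_dvdB|lia].
have -> : ((a - b).-1 = a - b.+1)%N by lia.
by rewrite natrB // -natr1 /deform_main /deform_beta; ring.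
Qed.
End Units.

Lemma adm_opp f : admissible f -> admissible (fun v : nat -> Zp => - f v).
Proof.
move=> af; rewrite (_ : (fun v => _) = fun v => (-1) * f v).
  by apply: adm_mul => //; apply: adm_const.
by apply/funext => v; rewrite mulN1r.
Qed.

Lemma adm_pochhammer f k :
  admissible f -> admissible (fun v : nat -> Zp => pochhammer (f v) k).
Proof. by move=> af; apply: adm_prod => i; apply: adm_add => //; apply: adm_const. Qed.

Ltac adm := repeat first [exact: adm_const | exact: adm_coord | assumption
  | apply: adm_add | apply: adm_opp | apply: adm_pochhammer | apply: adm_mul ].

Lemma deform_defect_fun_admissible : admissible deform_defect_fun.
Proof.
apply: adm_add; last first.
  apply: adm_opp; apply: adm_mul; first by rewrite /deform_main; adm.
  apply: adm_inv; first by rewrite /deform_main /deform_beta; adm.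
  move=> v hv; do ![rewrite unitrMl ?deform_value_den_unit //];
  rewrite -?addrA; do ![apply: poch_1z_unit | apply: padic_dvdD | apply: padic_dvdN | lia | exact: hv].
apply: adm_sum => k; have lek : (k <= 2 * a + b)%N by rewrite -ltnS.
apply: adm_mul.
  rewrite /deform_last /deform_beta /deform_main /deform_par; apply: adm_mul; last by adm.
  by apply: adm_mul; [case: (k < a - b)%N|]; adm.
apply: adm_inv.
  rewrite /deform_last /deform_beta /deform_main /deform_par; adm.
  by apply: adm_prod => i; adm.
move=> v hv; have [u1 u2 u3 u4] := deform_term_den_unit (hv 0) (hv 1%N) (hv 2) (hv 3) (hv 4) lek.
by rewrite !unitrM u1 (u2 _ (hv 1%N)) (u2 _ (hv 2)) (u2 _ (hv 3)) u3 u4.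
Qed.

Local Notation K := {fraction Zp}.
Local Notation phi := (@FracField.tofrac Zp).
Implicit Types z : Zp.

Lemma unit_frac_neq0 z : z \is a GRing.unit -> phi z != 0.
Proof. by move=> uz; rewrite tofrac_eq0; apply: contraTneq uz => ->; rewrite unitr0. Qed.

Lemma frac_char0 j : (j.+1)%:R != 0 :> K.
Proof. by rewrite -(rmorph_nat phi) tofrac_eq0 padic_natr_eq0. Qed.

Lemma nz_pos (w : K) z c : w = c%:R + phi z -> padic_dvd 1 z -> (0 < c < p)%N -> w != 0.
Proof.
move=> -> dz ltc; rewrite -(rmorph_nat phi) -rmorphD unit_frac_neq0 //.
exact: (@padic_unit_pos _ z c).
Qed.

Lemma nz_neg (w : K) z c : w = phi z - c%:R -> padic_dvd 1 z -> (0 < c < p)%N -> w != 0.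
Proof.
move=> -> dz ltc; rewrite -(rmorph_nat phi) -rmorphB unit_frac_neq0 //.
exact: (@padic_unit_neg _ z c).
Qed.

Lemma poch_nz (w : K) z k : w = 1 + phi z -> padic_dvd 1 z -> (k <= 2 * a + b)%N ->
  pochhammer w k != 0.
Proof.
move=> -> dz lek; rewrite -(rmorph1 phi) -rmorphD -rmorph_pochhammer unit_frac_neq0 //.
exact: poch_1z_unit.
Qed.

Section Vanishing.
Variables x0 x1 x2 x3 y : Zp.
Hypotheses (d0 : padic_dvd 1 x0) (d1 : padic_dvd 1 x1) (d2 : padic_dvd 1 x2)
  (d3 : padic_dvd 1 x3) (dy : padic_dvd 1 y).

Lemma frac_deform_main : phi (deform_main x0) = deform_main (phi x0).
Proof. by rewrite rmorphB rmorph_nat. Qed.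
Lemma frac_deform_par x : phi (deform_par x) = deform_par (phi x).
Proof. by rewrite rmorphB rmorph_nat. Qed.
Lemma frac_deform_beta : phi (deform_beta y) = deform_beta (phi y).
Proof. by rewrite rmorphB rmorph_nat. Qed.
Lemma frac_deform_last : phi (deform_last x0 x1 x2 x3 y)
  = deform_last (phi x0) (phi x1) (phi x2) (phi x3) (phi y).
Proof.
by rewrite /deform_last /deform_main /deform_par /deform_beta
  !(rmorphB, rmorphD, rmorphM, rmorph1, rmorph_nat).
Qed.

Lemma frac_deform_term k : (k <= 2 * a + b)%N -> x0 != y ->
  phi (deform_term x0 x1 x2 x3 y k) = phi (x0 - y) *
   dougall_term (deform_main (phi x0)) (deform_par (phi x1)) (deform_par (phi x2)) (deform_par (phi x3))
     (deform_beta (phi y)) (deform_last (phi x0) (phi x1) (phi x2) (phi x3) (phi y)) k.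
Proof.
move=> lek neq; have [u1 u2 u3 u4] := deform_term_den_unit d0 d1 d2 d3 dy lek.
have phiD : phi (\prod_(i < k | i != (a - b).-1 :> nat) (1 + deform_main x0 - deform_beta y + i%:R))
  = \prod_(i < k | i != (a - b).-1 :> nat) (1 + deform_main (phi x0) - deform_beta (phi y) + i%:R).
  rewrite rmorph_prod; apply: eq_bigr => i _.
  by rewrite /deform_main /deform_beta !(rmorphB, rmorphD, rmorph1, rmorph_nat).
have neq' : phi x0 != phi y by rewrite -subr_eq0 -rmorphB tofrac_eq0 subr_eq0.
have D0 := unit_frac_neq0 u3; rewrite phiD in D0.
rewrite rmorphB -(deform_term_dougall _ _ _ D0 ltba neq').
rewrite /deform_term !rmorphM rmorphV; last first.
  by rewrite !unitrM u1 (u2 _ d1) (u2 _ d2) (u2 _ d3) u3 u4.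

rewrite !rmorphM -phiD !rmorph_pochhammer /= (fun_if phi).
have E1 w : phi (1 + deform_main x0 - w) = 1 + deform_main (phi x0) - phi w.
  by rewrite -frac_deform_main -(rmorph1 phi) -rmorphD -rmorphB.
have E2 : phi (deform_main x0 + 2%:R * k%:R) = deform_main (phi x0) + 2%:R * k%:R.
  by rewrite rmorphD rmorphM !rmorph_nat /= frac_deform_main.
rewrite E2 !E1 frac_deform_last frac_deform_main !frac_deform_par frac_deform_beta rmorphB.
by rewrite !rmorph_nat rmorph1.
Qed.

Lemma frac_deform_value :
  phi (deform_value x0 x1 x2 x3 y) = deform_value (phi x0) (phi x1) (phi x2) (phi x3) (phi y).
Proof.
rewrite /deform_value !rmorphM rmorphV; last first.
  do ![rewrite unitrMl ?deform_value_den_unit //];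
  rewrite -?addrA; do ![apply: poch_1z_unit | apply: padic_dvdD | apply: padic_dvdN | lia | done].
by rewrite /deform_main /deform_beta !rmorphM !rmorph_pochhammer
  !(rmorphB, rmorphD, rmorphM, rmorph1, rmorph_nat).
Qed.

Lemma frac_deform_defect : x0 != y ->
  phi (deform_defect x0 x1 x2 x3 y) = phi (x0 - y) *
   (\sum_(k < (2 * a + b).+1) dougall_term (deform_main (phi x0)) (deform_par (phi x1))
     (deform_par (phi x2)) (deform_par (phi x3))
     (deform_beta (phi y)) (deform_last (phi x0) (phi x1) (phi x2) (phi x3) (phi y)) k)
   - deform_value (phi x0) (phi x1) (phi x2) (phi x3) (phi y).
Proof.
move=> neq; rewrite rmorphB /= frac_deform_value rmorph_sum mulr_sumr; congr (_ - _).
by apply: eq_bigr => k _; apply: frac_deform_term; rewrite // -ltnS.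
Qed.
End Vanishing.
End Admissible.
End Deformation.

(** * Reversal of well-poised sums and Dougall's product on the hyperplanes *)

Section FieldIdentities.
Variables (F : fieldType).
Implicit Types A b c d e f x : F.

Lemma poch_neq0_le x m k : (k <= m)%N -> pochhammer x m != 0 -> pochhammer x k != 0.
Proof. by move=> /subnKC <-; rewrite pochhammerD mulf_eq0 negb_or => /andP[]. Qed.

(** Comes from (x)_(n-j) (1 - n - x)_j = (-1)^j (x)_n, used for j = k and for j = n - k. *)
Lemma pochhammer_well_poised x n k : (k <= n)%N ->
  pochhammer (1 - n%:R - x) n != 0 ->
  pochhammer x (n - k) / pochhammer (1 - n%:R - x) (n - k)
  = (-1) ^+ n * (pochhammer x k / pochhammer (1 - n%:R - x) k).
Proof.
move=> lek nz.
have aux j : (j <= n)%N ->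
    pochhammer x (n - j) * pochhammer (1 - n%:R - x) j = (-1) ^+ j * pochhammer x n.
  move=> lej; rewrite [X in _ * X]pochhammer_rev -[in RHS](subnK lej) pochhammerD.
  rewrite (_ : 1 - j%:R - (1 - n%:R - x) = x + (n - j)%:R); first by ring.
  by rewrite natrB //; ring.
have := aux _ (leq_subr k n); rewrite subKn // => E1; have E2 := aux _ lek.
apply/eqP; rewrite mulrA eqr_div ?(poch_neq0_le _ nz) ?leq_subr //.
apply/eqP; rewrite E2 -mulrA E1 mulrA -exprD -[in RHS]signr_odd -[in LHS]signr_odd oddD oddB //.
by case: (odd n); case: (odd k).
Qed.

(** Under k -> n - k each of the six quotients of Pochhammer symbols gains (-1)^n, which cancels
    overall, while the factor A + 2k = 2k - n changes sign; hence the sum equals its own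
    opposite. *)
Lemma dougall_antisymmetric n M b c d e f : (2%:R : F) != 0 -> (n <= M)%N ->
    (n`!)%:R != 0 :> F ->
    [/\ pochhammer (1 - n%:R - b) n != 0, pochhammer (1 - n%:R - c) n != 0,
        pochhammer (1 - n%:R - d) n != 0, pochhammer (1 - n%:R - e) n != 0
      & pochhammer (1 - n%:R - f) n != 0] ->
  \sum_(k < M.+1) dougall_term (- n%:R) b c d e f k = 0.
Proof.
move=> two lenM nf [nb nc nd ne nf']; set T := dougall_term _ _ _ _ _ _.
have E1 : 1 - n%:R - - n%:R = 1 :> F by ring.
have nz x : x \in [:: - n%:R; b; c; d; e; f] -> pochhammer (1 - n%:R - x) n != 0.
  rewrite !inE; do ![case/orP=> [/eqP->|] //]; last by move/eqP->.
  by rewrite E1 -fact_pochhammer.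
have -> : \sum_(k < M.+1) T k = \sum_(k < n.+1) T k.
  rewrite -!(big_mkord predT) /= (big_cat_nat (leq0n n.+1)) ?ltnS //=.
  rewrite [X in _ + X]big_nat_cond [X in _ + X]big1 ?addr0 // => k /andP[/andP[ltnk _] _].
  by rewrite /T /dougall_term (pochhammer_eq0 _ ltnk) !(mulr0, mul0r).
have TE k : T k = (- n%:R + 2%:R * k%:R) * \prod_(x <- [:: - n%:R; b; c; d; e; f])
    (pochhammer x k / pochhammer (1 - n%:R - x) k).
  rewrite /T /dougall_term !big_cons big_nil mulr1 -mulrA; congr (_ * _).
  rewrite E1 -fact_pochhammer.
  by rewrite !invfM; ring.
have anti k : (k <= n)%N -> T (n - k)%N = - T k.
  move=> lek; rewrite !TE natrB // mulrBr.
  rewrite (eq_big_seq (fun x => (-1) ^+ n * (pochhammer x k / pochhammer (1 - n%:R - x) k))).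
    rewrite !big_cons !big_nil.
    have s2 : (-1) ^+ n * (-1) ^+ n = 1 :> F by rewrite -expr2 sqrr_sign.
    set s := (-1) ^+ n in s2 *.
    transitivity ((- (- n%:R + 2%:R * k%:R)) * (s * s) * (s * s) * (s * s)
      * (pochhammer (- n%:R) k / pochhammer (1 - n%:R - - n%:R) k *
     (pochhammer b k / pochhammer (1 - n%:R - b) k *
      (pochhammer c k / pochhammer (1 - n%:R - c) k *
       (pochhammer d k / pochhammer (1 - n%:R - d) k *
        (pochhammer e k / pochhammer (1 - n%:R - e) k *
         (pochhammer f k / pochhammer (1 - n%:R - f) k * 1))))))); first by ring.
    by rewrite s2 !mulr1 mulNr.
  by move=> x xin; apply: pochhammer_well_poised => //; apply: nz.
set S := \sum_(k < _) _; have SE : S = - S.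
  rewrite [LHS](reindex_inj rev_ord_inj) /= /S -sumrN; apply: eq_bigr => k _.
  by rewrite subSS anti // -ltnS.
apply/eqP; move/eqP: SE; rewrite -subr_eq0 opprK -mulr2n -mulr_natl mulf_eq0.
by rewrite (negPf two).
Qed.

Variables (a b : nat).
Hypotheses (b_gt0 : (0 < b)%N) (ltba : (b < a)%N).

(* Dougall's product at n = a, where the parameter deform_par x1 is -a. *)
Lemma deform_value_x1 (x0 x2 x3 y : F) : x0 != y ->
  pochhammer (1 + deform_main a x0 - deform_beta b y) (a - b).-1 != 0 ->
  [/\ pochhammer (1 + x0 - x2) a != 0, pochhammer (1 + x0 - x3) a != 0
    & pochhammer (1 + x0 - x2 - x3) a != 0] ->
  [/\ pochhammer (1 + x0 - y) b != 0, pochhammer (1 + x0 - x2 - y) (a + b) != 0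
    , pochhammer (1 + x0 - x3 - y) (a + b) != 0 & pochhammer (1 + x0 - x2 - x3 - y) (a + a + b) != 0] ->
  let A := deform_main a x0 in let c := deform_par a x2 in let d := deform_par a x3 in
  let e := deform_beta b y in
  (x0 - y) * (A * (pochhammer (1 + A) a * pochhammer (1 + A - c - d) a
         * pochhammer (1 + A - c - e) a * pochhammer (1 + A - d - e) a)
    / (pochhammer (1 + A - c) a * pochhammer (1 + A - d) a * pochhammer (1 + A - e) a
       * pochhammer (1 + A - c - d - e) a)) = deform_value a b x0 0 x2 x3 y.
Proof.
rewrite -subr_eq0 => w0 nm [n1 n2 n3] [n4 n5 n6 n7] A c d e.
have E1 : pochhammer (1 + A) a = pochhammer (1 + A) a.-1 * x0.
  have -> : pochhammer (1 + A) a = pochhammer (1 + A) a.-1.+1 by congr pochhammer; lia.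
  rewrite pochhammerS; congr (_ * _); rewrite /A /deform_main.
  by rewrite -subn1 natrB; [ring | lia].
have E2 : pochhammer (1 + A - e) a
    = pochhammer (1 + A - e) (a - b).-1 * (x0 - y) * pochhammer (1 + x0 - y) b.
  have -> : pochhammer (1 + A - e) a = pochhammer (1 + A - e) ((a - b).-1 + b.+1).
    by congr pochhammer; lia.
  have Em : (a - b).-1%:R = a%:R - b%:R - 1 :> F.
    have -> : ((a - b).-1 = a - b.+1)%N by lia.
    by rewrite natrB // -natr1; ring.
  rewrite pochhammerD pochhammerSl !mulrA Em; congr (_ * _ * _).
    by rewrite /A /e /deform_main /deform_beta; ring.
  by congr pochhammer; rewrite /A /e /deform_main /deform_beta; ring.
have E3 : pochhammer (1 + A - c) a = pochhammer (1 + x0 - x2) a.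
  by congr pochhammer; rewrite /A /c /deform_main /deform_par; ring.
have E4 : pochhammer (1 + A - d) a = pochhammer (1 + x0 - x3) a.
  by congr pochhammer; rewrite /A /d /deform_main /deform_par; ring.
have E5 : pochhammer (1 + x0 - x2 - x3) (a + a)
  = pochhammer (1 + x0 - x2 - x3) a * pochhammer (1 + A - c - d) a.
  by rewrite pochhammerD; congr (_ * pochhammer _ _);
    rewrite /A /c /d /deform_main /deform_par; ring.
have E6 : pochhammer (1 + x0 - x2 - y) (a + b)
  = pochhammer (1 + x0 - x2 - y) b * pochhammer (1 + A - c - e) a.
  rewrite addnC pochhammerD; congr (_ * pochhammer _ _).
  by rewrite /A /c /e /deform_main /deform_par /deform_beta; ring.
have E7 : pochhammer (1 + x0 - x3 - y) (a + b)
  = pochhammer (1 + x0 - x3 - y) b * pochhammer (1 + A - d - e) a.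
  rewrite addnC pochhammerD; congr (_ * pochhammer _ _).
  by rewrite /A /d /e /deform_main /deform_par /deform_beta; ring.
have E8 : pochhammer (1 + x0 - x2 - x3 - y) (a + a + b)
  = pochhammer (1 + x0 - x2 - x3 - y) (a + b) * pochhammer (1 + A - c - d - e) a.
  rewrite -addnA addnC pochhammerD; congr (_ * pochhammer _ _).
  by rewrite natrD /A /c /d /e /deform_main /deform_par /deform_beta; ring.
rewrite /deform_value !subr0 -/A -/e.
move: n5 n6 n7; rewrite E6 E7 E8 !mulf_eq0 !negb_or.
move=> /andP[n5 m5] /andP[n6 m6] /andP[n7 m7].
rewrite E1 E2 E3 E4 E5.
move: (x0 - y) w0 (pochhammer (1 + A - e) (a - b).-1) nm => w w0 r0 nm.
move: (pochhammer (1 + x0 - x2) a) n1 (pochhammer (1 + x0 - x3) a) n2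
  (pochhammer (1 + x0 - x2 - x3) a) n3 (pochhammer (1 + x0 - y) b) n4 => r1 n1 r2 n2 r3 n3 r4 n4.
move: (pochhammer (1 + x0 - x2 - y) b) n5 (pochhammer (1 + A - c - e) a) m5
 (pochhammer (1 + x0 - x3 - y) b) n6 (pochhammer (1 + A - d - e) a) m6
 (pochhammer (1 + x0 - x2 - x3 - y) (a + b)) n7 (pochhammer (1 + A - c - d - e) a) m7.
move=> r5 n5 s5 m5 r6 n6 s6 m6 r7 n7 s7 m7.
move: (pochhammer (1 + A) a.-1) (pochhammer (1 + A - c - d) a) => t1 t2.
by field; do ?[apply/andP; split].
Qed.

(* Dougall's product at n = b, where deform_beta y is -b. *)
Lemma deform_value_y (x0 x1 x2 x3 : F) : x0 != 0 ->
  pochhammer (1 + deform_main a x0 + b%:R) (a - b).-1 != 0 ->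
  [/\ pochhammer (1 + x0 - x1) b != 0, pochhammer (1 + x0 - x2) b != 0
    & pochhammer (1 + x0 - x3) b != 0] ->
  [/\ pochhammer (1 + x0 - x1 - x2) a != 0, pochhammer (1 + x0 - x1 - x3) a != 0,
      pochhammer (1 + x0 - x2 - x3) a != 0
    & pochhammer (1 + x0 - x1 - x2 - x3) (a + a + b) != 0] ->
  let A := deform_main a x0 in let c := deform_par a x1 in let d := deform_par a x2 in
  let e := deform_par a x3 in
  x0 * (A * (pochhammer (1 + A) b * pochhammer (1 + A - c - d) b
         * pochhammer (1 + A - c - e) b * pochhammer (1 + A - d - e) b)
    / (pochhammer (1 + A - c) b * pochhammer (1 + A - d) b * pochhammer (1 + A - e) b
       * pochhammer (1 + A - c - d - e) b)) = deform_value a b x0 x1 x2 x3 0.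
Proof.
move=> w0 nm [n1 n2 n3] [n4 n5 n6 n7] A c d e.
have E1 : pochhammer (1 + A) a.-1 = pochhammer (1 + A) b * pochhammer (1 + A + b%:R) (a - b).-1.
  by rewrite -pochhammerD; congr pochhammer; lia.
have E2 : 1 + A - deform_beta b 0 = 1 + A + b%:R by rewrite /deform_beta; ring.
have E3 : pochhammer (1 + A - c) b = pochhammer (1 + x0 - x1) b.
  by congr pochhammer; rewrite /A /c /deform_main /deform_par; ring.
have E4 : pochhammer (1 + A - d) b = pochhammer (1 + x0 - x2) b.
  by congr pochhammer; rewrite /A /d /deform_main /deform_par; ring.
have E5 : pochhammer (1 + A - e) b = pochhammer (1 + x0 - x3) b.
  by congr pochhammer; rewrite /A /e /deform_main /deform_par; ring.
have E6 : pochhammer (1 + x0 - x1 - x2) (a + b)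
  = pochhammer (1 + x0 - x1 - x2) a * pochhammer (1 + A - c - d) b.
  by rewrite pochhammerD; congr (_ * pochhammer _ _);
    rewrite /A /c /d /deform_main /deform_par; ring.
have E7 : pochhammer (1 + x0 - x1 - x3) (a + b)
  = pochhammer (1 + x0 - x1 - x3) a * pochhammer (1 + A - c - e) b.
  by rewrite pochhammerD; congr (_ * pochhammer _ _);
    rewrite /A /c /e /deform_main /deform_par; ring.
have E8 : pochhammer (1 + x0 - x2 - x3) (a + b)
  = pochhammer (1 + x0 - x2 - x3) a * pochhammer (1 + A - d - e) b.
  by rewrite pochhammerD; congr (_ * pochhammer _ _);
    rewrite /A /d /e /deform_main /deform_par; ring.
have E9 : pochhammer (1 + x0 - x1 - x2 - x3) (a + a + b)
  = pochhammer (1 + x0 - x1 - x2 - x3) (a + a) * pochhammer (1 + A - c - d - e) b.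
  by rewrite pochhammerD natrD; congr (_ * pochhammer _ _);
    rewrite /A /c /d /e /deform_main /deform_par; ring.
rewrite /deform_value !subr0 -/A E2 E3 E4 E5 E1 E6 E7 E8 E9.
move: n7; rewrite E9 mulf_eq0 negb_or => /andP[n7 m7].
rewrite -/A in nm.
move: (pochhammer (1 + A + b%:R) (a - b).-1) nm => r0 nm.
move: (pochhammer (1 + x0 - x1) b) n1 (pochhammer (1 + x0 - x2) b) n2
  (pochhammer (1 + x0 - x3) b) n3 => r1 n1 r2 n2 r3 n3.
move: (pochhammer (1 + x0 - x1 - x2) a) n4 (pochhammer (1 + x0 - x1 - x3) a) n5
  (pochhammer (1 + x0 - x2 - x3) a) n6 => r4 n4 r5 n5 r6 n6.
move: (pochhammer (1 + x0 - x1 - x2 - x3) (a + a)) n7 (pochhammer (1 + A - c - d - e) b) m7.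
move=> r7 n7 s7 m7.
move: (pochhammer (1 + A) b) (pochhammer (1 + A - c - d) b) (pochhammer (1 + A - c - e) b)
 (pochhammer (1 + A - d - e) b) => t1 t2 t3 t4.
by field; do ?[apply/andP; split].
Qed.
End FieldIdentities.

(** * Vanishing of the defect on the five coordinate hyperplanes *)

Section Vanishing.
Context (p : nat) (p_pr : prime p) (a b : nat).
Local Notation Zp := (padic_int p_pr).
Hypotheses (b_gt0 : (0 < b)%N) (ltba : (b < a)%N) (le_p : (2 * a + b <= p.-1)%N).
Local Notation K := {fraction Zp}.
Local Notation phi := (@FracField.tofrac Zp).
Implicit Types x y z : Zp.

Let nzp := @nz_pos p p_pr.
Let nzn := @nz_neg p p_pr.
Let pnz := @poch_nz a b p p_pr b_gt0 ltba le_p.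

Ltac dvd := repeat first [assumption | apply: padic_dvd0 | apply: padic_dvdB | apply: padic_dvdD].

Lemma frac_sub_neq0 x y : x != y -> phi x - phi y != 0.
Proof. by move=> neq; rewrite -rmorphB tofrac_eq0 subr_eq0. Qed.

Lemma main_shift_neq0 x0 j : padic_dvd 1 x0 -> x0 != 0 -> (j <= 2 * a)%N ->
  deform_main a (phi x0) + j%:R != 0.
Proof.
move=> d0 n0 lej; have [ltj|gtj|->] := ltngtP j a.
- apply: (nzn (z := x0) (c := (a - j)%N)); rewrite // ?natrB ?(ltnW ltj) //; last by lia.
  by rewrite /deform_main; ring.
- apply: (nzp (z := x0) (c := (j - a)%N)); rewrite // ?natrB ?(ltnW gtj) //; last by lia.
  by rewrite /deform_main; ring.
by rewrite /deform_main subrK tofrac_eq0.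
Qed.

Lemma beta_shift_neq0 x0 y j : padic_dvd 1 x0 -> padic_dvd 1 y -> x0 != y -> (j <= 2 * a)%N ->
  1 + deform_main a (phi x0) - deform_beta b (phi y) + j%:R != 0.
Proof.
move=> d0 dy neq lej.
have dz : padic_dvd 1 (x0 - y) by dvd.
have [ltj|gtj|Ej] := ltngtP (b + j.+1)%N a.
- apply: (nzn (z := x0 - y) (c := (a - (b + j.+1))%N)) => //; last by lia.
  by rewrite natrB ?(ltnW ltj) // natrD -(natr1 j) rmorphB /deform_main /deform_beta; ring.
- apply: (nzp (z := x0 - y) (c := (b + j.+1 - a)%N)) => //; last by lia.
  by rewrite natrB ?(ltnW gtj) // natrD -(natr1 j) rmorphB /deform_main /deform_beta; ring.
rewrite (_ : _ + _ = phi x0 - phi y) ?frac_sub_neq0 //.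
by rewrite /deform_main /deform_beta -Ej natrD -natr1; ring.
Qed.

Lemma poch_beta_nz x0 y k : padic_dvd 1 x0 -> padic_dvd 1 y -> x0 != y -> (k <= 2 * a)%N ->
  pochhammer (1 + deform_main a (phi x0) - deform_beta b (phi y)) k != 0.
Proof.
by move=> d0 dy neq lek; apply: pochhammer_neq0 => j ltj; apply: beta_shift_neq0 => //; lia.
Qed.

(** At x1 = 0 the parameter is -a and Dougall's formula applies with n = a. The two inequalities are
    what its regularity costs: A + j is x0 at j = a, and 1 + A - [deform_beta] + j is x0 - y at j =
    a - b - 1. *)
Lemma deform_defect_x1_generic x0 x2 x3 y :
  padic_dvd 1 x0 -> padic_dvd 1 x2 -> padic_dvd 1 x3 -> padic_dvd 1 y ->
  x0 != 0 -> x0 != y -> deform_defect a b x0 0 x2 x3 y = 0.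
Proof.
move=> d0 d2 d3 dy n0 neq; apply/eqP; rewrite -tofrac_eq0.
rewrite (frac_deform_defect b_gt0 ltba le_p d0 (padic_dvd0 _ 1) d2 d3 dy neq).
have -> : phi 0 = 0 by apply: rmorph0.
have -> : deform_par a (0 : K) = - a%:R by rewrite /deform_par sub0r.
rewrite (@dougall_truncated _ _ _ _ _ _ a) //; first last.
- split=> j.
  + by move=> /andP[_ lej]; apply: main_shift_neq0.
  + move=> ltj; apply: (nzp (z := x0 + x0 - x2 - x3 - y) (c := (b + j.+1)%N)); [|dvd|lia].
    rewrite natrD -(natr1 j) !rmorphB rmorphD /deform_main /deform_par /deform_beta; ring.
  + move=> ltj; apply: (nzp (z := x0 - x2 - x3 - y) (c := (a + b + j.+1)%N)); [|dvd|lia].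
    rewrite !natrD -(natr1 j) !rmorphB /deform_main /deform_par /deform_beta; ring.
  move=> ltj; split; last by apply: beta_shift_neq0 => //; lia.
    apply: (nzp (z := x0 - x2) (c := j.+1)); [|dvd|lia].
    by rewrite -(natr1 j) rmorphB /deform_main /deform_par; ring.
  apply: (nzp (z := x0 - x3) (c := j.+1)); [|dvd|lia].
  by rewrite -(natr1 j) rmorphB /deform_main /deform_par; ring.
- by rewrite /deform_last /deform_par sub0r; ring.
- by lia.
- exact: (frac_char0 p_pr).
rewrite rmorphB subr_eq0; apply/eqP/deform_value_x1 => //.
- by rewrite -subr_eq0 frac_sub_neq0.
- by apply: poch_beta_nz => //; lia.
- split; [apply: (pnz (z := x0 - x2))|apply: (pnz (z := x0 - x3))|
    apply: (pnz (z := x0 - x2 - x3))]; rewrite ?rmorphB ?addrA //; first [solve [dvd] | lia].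
split; [apply: (pnz (z := x0 - y))|apply: (pnz (z := x0 - x2 - y))|
    apply: (pnz (z := x0 - x3 - y))|apply: (pnz (z := x0 - x2 - x3 - y))];
  rewrite ?rmorphB ?addrA //; first [solve [dvd] | lia].
Qed.

Lemma deform_defect_y_generic x0 x1 x2 x3 :
  padic_dvd 1 x0 -> padic_dvd 1 x1 -> padic_dvd 1 x2 -> padic_dvd 1 x3 ->
  x0 != 0 -> deform_defect a b x0 x1 x2 x3 0 = 0.
Proof.
move=> d0 d1 d2 d3 n0; apply/eqP; rewrite -tofrac_eq0.
rewrite (frac_deform_defect b_gt0 ltba le_p d0 d1 d2 d3 (padic_dvd0 _ 1) n0).
have -> : phi 0 = 0 by apply: rmorph0.
have n00 : phi x0 != 0 by rewrite tofrac_eq0.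
rewrite subr0.
have nb := poch_beta_nz d0 (padic_dvd0 p_pr 1) n0.
have Eb : deform_beta b (phi 0) = - b%:R by rewrite rmorph0 /deform_beta sub0r.
have -> : deform_beta b (0 : K) = - b%:R by rewrite /deform_beta sub0r.
rewrite Eb opprK in nb.
rewrite (eq_bigr (fun k : 'I__ => dougall_term (deform_main a (phi x0)) (- b%:R)
  (deform_par a (phi x1)) (deform_par a (phi x2)) (deform_par a (phi x3))
  (deform_last a b (phi x0) (phi x1) (phi x2) (phi x3) 0) k)); last first.
  by move=> k _; rewrite /dougall_term; congr (_ * _ / _); ring.
rewrite (@dougall_truncated _ _ _ _ _ _ b); first last.
- split=> j.
  + by move=> /andP[_ lej]; apply: main_shift_neq0 => //; lia.
  + move=> ltj; apply: (nzp (z := x0 + x0 - x1 - x2 - x3) (c := (a + j.+1)%N)); [|dvd|lia].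
    rewrite natrD -(natr1 j) !rmorphB rmorphD /deform_main /deform_par /deform_beta; ring.
  + move=> ltj; apply: (nzp (z := x0 - x1 - x2 - x3) (c := (a + a + j.+1)%N)); [|dvd|lia].
    rewrite !natrD -(natr1 j) !rmorphB /deform_main /deform_par /deform_beta; ring.
  move=> ltj; split.
  + apply: (nzp (z := x0 - x1) (c := j.+1)); [|dvd|lia].
    by rewrite -(natr1 j) rmorphB /deform_main /deform_par; ring.
  + apply: (nzp (z := x0 - x2) (c := j.+1)); [|dvd|lia].
    by rewrite -(natr1 j) rmorphB /deform_main /deform_par; ring.
  apply: (nzp (z := x0 - x3) (c := j.+1)); [|dvd|lia].
  by rewrite -(natr1 j) rmorphB /deform_main /deform_par; ring.
- by rewrite /deform_last /deform_beta sub0r; ring.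
- by lia.
- exact: (frac_char0 p_pr).
rewrite subr_eq0; apply/eqP/(deform_value_y b_gt0 ltba n00).
- by apply: nb; lia.
- split; [apply: (pnz (z := x0 - x1))|apply: (pnz (z := x0 - x2))|
    apply: (pnz (z := x0 - x3))]; rewrite ?rmorphB ?addrA //; first [solve [dvd] | lia].
split; [apply: (pnz (z := x0 - x1 - x2))|apply: (pnz (z := x0 - x1 - x3))|
    apply: (pnz (z := x0 - x2 - x3))|apply: (pnz (z := x0 - x1 - x2 - x3))];
  rewrite ?rmorphB ?addrA //; first [solve [dvd] | lia].
Qed.

Lemma deform_defect_x0_generic x1 x2 x3 y :
  padic_dvd 1 x1 -> padic_dvd 1 x2 -> padic_dvd 1 x3 -> padic_dvd 1 y ->
  y != 0 -> deform_defect a b 0 x1 x2 x3 y = 0.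
Proof.
move=> d1 d2 d3 dy n0; apply/eqP; rewrite -tofrac_eq0.
have neq : 0 != y by rewrite eq_sym.
rewrite (frac_deform_defect b_gt0 ltba le_p (padic_dvd0 _ 1) d1 d2 d3 dy neq).
have E0 : phi 0 = 0 by apply: rmorph0.
rewrite [X in _ - X](_ : _ = 0); last by rewrite /deform_value E0 !(mulr0, mul0r).
have EA : deform_main a (phi 0) = - a%:R by rewrite E0 /deform_main sub0r.
have nb := poch_beta_nz (padic_dvd0 p_pr 1) dy neq.
have par x : padic_dvd 1 x -> pochhammer (1 - a%:R - deform_par a (phi x)) a != 0.
  move=> dx; apply: (pnz (z := - x)); [|exact: padic_dvdN|lia].
  by rewrite rmorphN /deform_par; ring.
have dz : padic_dvd 1 (x1 + x2 + x3 + y) by dvd.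
rewrite {1}EA dougall_antisymmetric; first by rewrite mulr0 subrr.
- exact: (frac_char0 p_pr 1).
- by lia.
- by rewrite -(prednK (fact_gt0 a)); apply: (frac_char0 p_pr).
split; [exact: par|exact: par|exact: par| |].
  by rewrite -EA; apply: nb; lia.
apply: pochhammer_neq0 => j ltj.
apply: (nzn (z := x1 + x2 + x3 + y) (c := (2 * a + b - j)%N)) => //; last by lia.
rewrite natrB; last by lia.
by rewrite natrD natrM !rmorphD /deform_last E0 /deform_main /deform_par /deform_beta; ring.
Qed.

Let D := @deform_defect_fun a b p p_pr.

Lemma padic_separated x y : (forall N, x N.+1 = y N.+1) -> x = y.
Proof. by move=> E; apply: padic_eqP => -[|N //]; rewrite !padic_at0. Qed.

(** Modulo each p^(N+1) the point may be replaced by a congruent generic one on the same hyperplane: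
    y is perturbed when x0 = 0, and x0 in all other cases. *)
Lemma deform_defect_fun_vanish v i : in_polydisc v -> (i < 5)%N -> v i = 0 -> D v = 0.
Proof.
move=> hv lti vi0; apply: padic_separated => N.
have dvdN (x x' : Zp) : x' N.+1 = x N.+1 -> padic_dvd 1 x -> padic_dvd 1 x'.
  by move=> E; rewrite !padic_dvdE (padic_congr_le (ltn0Sn N) E).
pose upd j x (k : nat) := if k == j then x else v k.
have approx j x : x N.+1 = v j N.+1 -> D v N.+1 = D (upd j x) N.+1.
  move=> E; apply: adm_congr => //; first exact: deform_defect_fun_admissible.
    by move=> k; rewrite /upd; case: eqP => [_|_] //; apply: dvdN E _.
  by move=> k; rewrite /upd; case: eqP => [->|_]; [exact/esym|].
have [E0|nE0] := eqVneq i 0%N.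
  have [y [Ey ny _]] := padic_avoid N.+1 (v 4) 0 0.
  rewrite E0 in vi0; rewrite (approx 4 y Ey).
  suff -> : D (upd 4 y) = 0 by [].
  by rewrite /D /deform_defect_fun /upd /= vi0 deform_defect_x0_generic //; apply: dvdN Ey _.
have [x0 [Ex n0 ny]] := padic_avoid N.+1 (v 0%N) 0 (v 4).
have d0 := dvdN _ _ Ex (hv 0%N).
rewrite (approx 0%N x0 Ex); suff -> : D (upd 0%N x0) = 0 by [].
rewrite /D /deform_defect_fun /upd /=.
case: i lti vi0 nE0 => [|[|[|[|[|]]]]] // _ -> _.
- by rewrite deform_defect_x1_generic.
- by rewrite -deform_defect_swap12 deform_defect_x1_generic.
- by rewrite -deform_defect_swap13 deform_defect_x1_generic.
by rewrite deform_defect_y_generic.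
Qed.

Lemma deform_defect_fun_factor : exists2 H, admissible H &
  forall v, in_polydisc v -> D v = (\prod_(i < 5) v i) * H v.
Proof.
apply: adm_factor; first exact: deform_defect_fun_admissible.
by move=> v i hv lti; apply: deform_defect_fun_vanish.
Qed.
End Vanishing.

(** * The defect modulo p^6 *)

(** The last k factors are read backwards with opposite signs. For x = 1 + z and m + k = p - 1 the
    tail becomes a symbol starting at 1 - (z + p). *)
Lemma pochhammer_split_rev (R : comNzRingType) (x y : R) m k :
  y = 1 - (m + k)%:R - x ->
  pochhammer x (m + k) = pochhammer x m * ((-1) ^+ k * pochhammer y k).
Proof.
move=> ->; rewrite pochhammerD (pochhammer_rev (x + m%:R)) natrD; congr (_ * (_ * _)).
by congr pochhammer; ring.
Qed.

Section SpecialPoint.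
Variables (F : fieldType) (p a b : nat).
Hypotheses (p_gt0 : (0 < p)%N) (b_gt0 : (0 < b)%N) (ltba : (b < a)%N)
  (le_p : (2 * a + b <= p.-1)%N).
Let P : F := p%:R.
Let n := (p.-1 - a - b)%N.

Local Notation q z := (pochhammer (1 + z) p.-1).

(** Since n + a + b = p - 1, the symbols of length n in Dougall's product and those in the
    interpolating product are complementary pieces of full products (1 + z)_(p-1) with z = 0, P, 2P,
    3P, after reflecting the tails. The identity is stated with the denominators of that quotient
    cleared. *)
Lemma deform_value_special :
  P != 0 ->
  [/\ pochhammer (1 + P) (a - b).-1 != 0, pochhammer (1 + P) a != 0,
      pochhammer (1 - 2%:R * P) b != 0 & pochhammer (1 - 4%:R * P) (a + a + b) != 0] ->
  pochhammer (1 + 2%:R * P) n != 0 -> pochhammer (1 + 2%:R * a%:R : F) n != 0 ->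
  let x0 := 3%:R * P in let y := 4%:R * P in
  let A := deform_main a x0 in let c := deform_par a P in
  (x0 - y) * (A * (pochhammer (1 + A) n * pochhammer (1 + A - c - c) n
         * pochhammer (1 + A - c - c) n * pochhammer (1 + A - c - c) n)
    / (pochhammer (1 + A - c) n * pochhammer (1 + A - c) n * pochhammer (1 + A - c) n
       * pochhammer (1 + A - c - c - c) n)) * (q (2%:R * P) ^+ 3 * q 0)
  = deform_value a b x0 P P P y * (q (3%:R * P) * q P ^+ 3).
Proof.
move=> P0 [nZ nPa nT nX] nS nW x0 y A c.
have En : p.-1%:R = P - 1 by rewrite /P -subn1 natrB.
pose sa : F := (-1) ^+ a; pose sb : F := (-1) ^+ b.
pose L := (p.-1 - (a + a + b))%N.
have H1 : q (3%:R * P) = pochhammer (1 + 3%:R * P) L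
    * (sb * pochhammer (1 - 4%:R * P) (a + a + b)).
  rewrite (_ : p.-1 = (L + (a + a + b))%N); last by rewrite /L; lia.
  rewrite (pochhammer_split_rev (y := 1 - 4%:R * P)); last first.
    rewrite (_ : (L + (a + a + b))%N = p.-1); last by rewrite /L; lia.
    by rewrite En; ring.
  congr (_ * (_ * _)).
  by rewrite /sb -signr_odd !oddD addbb addFb signr_odd.
have H2 : pochhammer (1 + A) n = pochhammer (1 + A) a.-1 * x0 * pochhammer (1 + x0) L.
  rewrite (_ : n = (a.-1 + L.+1)%N); last by rewrite /n /L; lia.
  rewrite pochhammerD pochhammerSl mulrA.
  have Ea : a.-1%:R = a%:R - 1 :> F by rewrite -subn1 natrB //; lia.
  by congr (_ * _ * pochhammer _ _); rewrite Ea /A /deform_main; ring.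
have H3 : q P = pochhammer (1 + P) a * pochhammer (1 + A - c - c) n
    * (sb * pochhammer (1 - 2%:R * P) b).
  have Ep : p.-1 = (a + n + b)%N by rewrite /n; lia.
  rewrite Ep (pochhammer_split_rev (y := 1 - 2%:R * P)); last first.
    by rewrite -Ep En; ring.
  rewrite pochhammerD; congr (_ * pochhammer _ _ * _).
  by rewrite /A /c /x0 /deform_main /deform_par; ring.
have EA : 1 + A - c = 1 + 2%:R * P by rewrite /A /c /x0 /deform_main /deform_par; ring.
have H4 : q (2%:R * P) = pochhammer (1 + A - c) n
    * (sa * sb * pochhammer (1 - 3%:R * P) (a + b)).
  have Ep : p.-1 = (n + (a + b))%N by rewrite /n; lia.
  rewrite Ep (pochhammer_split_rev (y := 1 - 3%:R * P)); last first.
    by rewrite -Ep En; ring.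
  by rewrite EA exprD.
have EW : 1 + A - c - c - c = 1 + 2%:R * a%:R by rewrite /A /c /x0 /deform_main /deform_par; ring.
(* This symbol runs past p, as 2a + n = p - 1 + (a - b); the factor P met on the way cancels against
   x0 - y = -P. *)
have H5 : pochhammer 1 (a + a) * pochhammer (1 + A - c - c - c) n
    = q 0 * P * pochhammer (1 + P) (a - b).-1.
  transitivity (pochhammer (1 : F) (a + a + n)).
    by rewrite [RHS]pochhammerD; congr (_ * pochhammer _ _); rewrite EW natrD; ring.
  rewrite addr0 (_ : (a + a + n = p.-1 + (a - b).-1.+1)%N); last by rewrite /n; lia.
  rewrite pochhammerD pochhammerSl mulrA En.
  by congr (_ * _ * pochhammer _ _); ring.
have H6 : pochhammer (1 + A - deform_beta b y) (a - b).-1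
    = - (sa * sb * pochhammer (1 + P) (a - b).-1).
  rewrite pochhammer_rev -mulNr; congr (_ * pochhammer _ _).
    rewrite /sa /sb -exprD -[LHS]signr_odd -[in RHS]signr_odd oddD.
    have -> : odd (a - b).-1 = ~~ (odd a (+) odd b).
      by rewrite -oddB ?(ltnW ltba) // -[in RHS](@prednK (a - b)) ?subn_gt0 //= negbK.
    by case: (odd a); case: (odd b); rewrite ?expr0 ?expr1 ?opprK.
  have -> : (a - b).-1%:R = a%:R - b%:R - 1 :> F.
    have -> : ((a - b).-1 = a - b.+1)%N by lia.
    by rewrite natrB // -(natr1 b); ring.
  by rewrite /A /x0 /y /deform_main /deform_beta; ring.
have sgn k : (-1) ^+ k = 1 :> F \/ (-1) ^+ k = - 1 :> F.
  by rewrite -signr_odd; case: odd; [right|left].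
rewrite /deform_value -/A H6.
have -> : 1 + x0 - P - P - y = 1 - 3%:R * P by rewrite /x0 /y; ring.
have -> : 1 + x0 - P - P - P = 1 by rewrite /x0; ring.
have -> : 1 + x0 - P - P = 1 + P by rewrite /x0; ring.
have -> : 1 + x0 - P - y = 1 - 2%:R * P by rewrite /x0 /y; ring.
have -> : 1 - y = 1 - 4%:R * P by [].
rewrite H1 H3 H4 H2 (_ : x0 - y = - P); last by rewrite /x0 /y; ring.
have EV : q 0 = pochhammer 1 (a + a) * pochhammer (1 + A - c - c - c) n
   / (P * pochhammer (1 + P) (a - b).-1).
  by rewrite H5 -mulrA mulfK ?mulf_neq0.
rewrite EV; rewrite -EA in nS; rewrite -EW in nW.
rewrite -/x0 in nT nX *.
move: (pochhammer (1 + A - c) n) nS (pochhammer (1 + A - c - c - c) n) nW.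
move: (pochhammer (1 + P) (a - b).-1) nZ (pochhammer (1 + P) a) nPa
 (pochhammer (1 - 2%:R * P) b) nT (pochhammer (1 - 4%:R * P) (a + a + b)) nX.
move=> Z nZ Pa nPa T nT X nX S nS W nW.
move: (pochhammer (1 + A) a.-1) (pochhammer (1 + x0) L) (pochhammer (1 + A - c - c) n)
  (pochhammer (1 - 3%:R * P) (a + b)) (pochhammer 1 (a + a)) => G1 L3 R U V.
rewrite /sa /sb.
by case: (sgn a) => ->; case: (sgn b) => ->; field; rewrite ?mulN1r ?opprK ?oppr_eq0;
  do ?[apply/andP; split].
Qed.
End SpecialPoint.

Section DefectBound.
Context (p : nat) (p_pr : prime p) (a b : nat).
Local Notation Zp := (padic_int p_pr).
Hypotheses (p_gt6 : (6 < p)%N) (b_gt0 : (0 < b)%N) (ltba : (b < a)%N)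
  (le_p : (2 * a + b <= p.-1)%N) (ge_p : (p.-1 <= 3 * a + 2 * b)%N).
Local Notation K := {fraction Zp}.
Local Notation phi := (@FracField.tofrac Zp).

Let P : Zp := p%:R.
Let n := (p.-1 - a - b)%N.
Local Notation q z := (pochhammer (1 + z) p.-1).

Lemma frac_pos_neq0 (w : K) j : w = j%:R + 1 -> w != 0.
Proof. by move=> ->; rewrite natr1; apply: frac_char0. Qed.

Let p0 : (0 < p)%N. Proof. exact: prime_gt0. Qed.
Let dP k : padic_dvd 1 (k%:R * P). Proof. by exists k%:R; rewrite expr1 mulrC. Qed.

Lemma deform_defect_special :
  deform_defect a b (3%:R * P) P P P (4%:R * P) * (q (2%:R * P) ^+ 3 * q 0)
  = deform_value a b (3%:R * P) P P P (4%:R * P)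
    * (q (3%:R * P) * q P ^+ 3 - q (2%:R * P) ^+ 3 * q 0).
Proof.
have dP1 : padic_dvd 1 P by rewrite -[P]mul1r; apply: (dP 1).
have neq : 3%:R * P != 4%:R * P.
  rewrite (inj_eq (mulIf (padic_p_neq0 p_pr))).
  by apply/eqP => /padic_natr_inj.
have phiP k : phi (k%:R * P) = k%:R * p%:R by rewrite rmorphM !rmorph_nat.
have phiP1 : phi P = p%:R by rewrite rmorph_nat.
have pnz (w : K) z k : w = 1 + phi z -> padic_dvd 1 z -> (k <= 2 * a + b)%N ->
    pochhammer w k != 0 by apply: (@poch_nz a b p p_pr b_gt0 ltba le_p).
have phiq z : phi (q z) = q (phi z) by rewrite rmorph_pochhammer rmorphD rmorph1.
have phiqX z k : phi (q z ^+ k) = q (phi z) ^+ k by rewrite rmorphXn /= phiq.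
have phiM x z : phi (x * z) = phi x * phi z by apply: rmorphM.
have phiB x z : phi (x - z) = phi x - phi z by apply: rmorphB.
have phi31 x z : phi (q x ^+ 3 * q z) = q (phi x) ^+ 3 * q (phi z).
  by rewrite [LHS]phiM phiqX phiq.
have phi13 x z : phi (q z * q x ^+ 3) = q (phi z) * q (phi x) ^+ 3.
  by rewrite [LHS]phiM phiqX phiq.
have phi0 : phi 0 = 0 by apply: rmorph0.
have phiN x : phi (- x) = - phi x by apply: rmorphN.
have phi_eq x z : phi x = phi z -> x = z.
  by move/eqP; rewrite -subr_eq0 -phiB tofrac_eq0 subr_eq0 => /eqP.
apply: phi_eq; rewrite [LHS]phiM [RHS]phiM.
rewrite (frac_deform_defect b_gt0 ltba le_p (dP 3) dP1 dP1 dP1 (dP 4) neq).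
rewrite (frac_deform_value b_gt0 ltba le_p (dP 3) dP1 dP1 dP1 (dP 4)).
have -> : phi (q (3%:R * P) * q P ^+ 3 - q (2%:R * P) ^+ 3 * q 0)
    = q (3%:R * p%:R) * q p%:R ^+ 3 - q (2%:R * p%:R) ^+ 3 * q 0.
  by rewrite phiB phi13 phi31 phi0 !phiP phiP1.
have -> : phi (q (2%:R * P) ^+ 3 * q 0) = q (2%:R * p%:R) ^+ 3 * q 0.
  by rewrite phi31 phi0 !phiP.
rewrite phiB !phiP phiP1.
have pK0 : (p%:R : K) != 0 by rewrite -phiP1 tofrac_eq0; apply: padic_p_neq0.
have Ep : p%:R = p.-1%:R + 1 :> K by rewrite natr1 (prednK p0).
have := @deform_value_special K p a b p0 b_gt0 ltba le_p pK0.
move=> h; have {h} := h _ _ _.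
set y := 4%:R * p%:R; set x0 := 3%:R * p%:R; set A := deform_main a x0.
set c := deform_par a p%:R.
have Elast : deform_last a b x0 p%:R p%:R p%:R y = - n%:R.
  rewrite /deform_last /deform_main /deform_par /deform_beta /x0 /y /n !natrB; try lia.
  by rewrite Ep; ring.
rewrite (eq_bigr (fun k : 'I__ => dougall_term A (- n%:R) c c c (deform_beta b y) k)); last first.
  by move=> k _; rewrite Elast /dougall_term; congr (_ * _ / _); ring.
rewrite (@dougall_truncated _ _ _ _ _ _ n); first last.
- split=> j.
  + move=> _; apply: (@frac_pos_neq0 _ (p.-1 + p + p - a + j)).
    rewrite natrD natrB ?natrD; last by lia.
    by rewrite /A /deform_main /x0 Ep; ring.
  + move=> _; apply: (@frac_pos_neq0 _ (a + p + p + p + j)).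
    by rewrite !natrD /A /c /deform_main /deform_par /x0; ring.
  + move=> _; apply: (@frac_pos_neq0 _ (a + a + j)).
    by rewrite !natrD /A /c /deform_main /deform_par /x0; ring.
  have hc : 1 + A - c + j%:R != 0.
    apply: (@frac_pos_neq0 _ (p + p + j)).
    by rewrite !natrD /A /c /deform_main /deform_par /x0; ring.
  by [].
- rewrite /deform_beta /A /c /deform_main /deform_par /x0 /y /n !natrB; try lia.
  by rewrite Ep; ring.
(* The inequality n <= 2a + b is the lower bound p - 1 <= 3a + 2b. *)
- by rewrite /n; lia.
- exact: frac_char0.
have aux (X V Q W : K) : X * Q = V * W -> (X - V) * Q = V * (W - Q).
  by move=> E; rewrite mulrBl mulrBr E.
move=> h; apply: aux; apply: h.
- split.
  + by apply: (pnz _ P); rewrite ?phiP1 //; lia.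
  + by apply: (pnz _ P); rewrite ?phiP1 //; lia.
  + by apply: (pnz _ (- (2%:R * P))); [by rewrite phiN phiP|exact: padic_dvdN|lia].
  by apply: (pnz _ (- (4%:R * P))); [by rewrite phiN phiP|exact: padic_dvdN|lia].
- apply: pochhammer_neq0 => j _; apply: (@frac_pos_neq0 _ (p + p + j)).
  by rewrite !natrD; ring.
apply: pochhammer_neq0 => j _; apply: (@frac_pos_neq0 _ (a + a + j)).
by rewrite !natrD; ring.
Qed.

(** One p comes from the factor x0 = 3P of [deform_value], and p^5 from the third difference with m
    = 0 and h = 1. *)
Lemma deform_defect_special_dvd :
  padic_dvd 6 (deform_defect a b (3%:R * P) P P P (4%:R * P)).
Proof.
have uq z : padic_dvd 1 z -> q z \is a GRing.unit := @pochhammer_p_unit p p_pr p_gt6 z.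
apply: (@padic_dvd_unitMl _ _ _ (q (2%:R * P) ^+ 3 * q 0)).
  by rewrite unitrMl ?unitrX ?uq //; apply: padic_dvd0.
rewrite mulrC deform_defect_special; apply: (@padic_dvdM _ _ 1 5).
  by rewrite /deform_value; apply/padic_dvdMr/padic_dvdMr/padic_dvdMl/dP.
have /padic_congrP := @pochhammer_p_third_difference p p_pr p_gt6 0 1.
have -> : p%:R * (0 + 1 *+ 3) = 3%:R * P by rewrite /P; ring.
have -> : p%:R * (0 + 1 *+ 2) = 2%:R * P by rewrite /P; ring.
by rewrite add0r mulr0 mulr1.
Qed.

Lemma deform_defect_fun_dvd (v : nat -> Zp) : in_polydisc v -> padic_dvd 6 (deform_defect_fun a b v).
Proof.
move=> hv; have [H aH EH] := deform_defect_fun_factor p_pr b_gt0 ltba le_p.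
have uP k : (0 < k < 7)%N -> (k%:R : Zp) \is a GRing.unit.
  move=> /andP[k0 ltk]; rewrite padic_unit_nat; apply/negP => /dvdn_leq -/(_ k0).
  by rewrite leqNgt (leq_trans ltk).
pose w (i : nat) : Zp := if i == 0%N then 3%:R * P else if i == 4 then 4%:R * P else P.
have hw : in_polydisc w.
  move=> i; rewrite /w; case: eqP => _; first exact: dP.
  by case: eqP => _; [exact: dP|rewrite -[P]mul1r; apply: (dP 1)].
have dHw : padic_dvd 1 (H w).
  have := deform_defect_special_dvd; rewrite (EH w hw : deform_defect _ _ _ _ _ _ _ = _).
  rewrite !big_ord_recr big_ord0 /w /=.
  (* The coordinates contribute p^5 times 12, a unit for p > 6, so the sixth power of p must divide
     out of [H w]. *)
  have -> : 1 * (3%:R * P) * P * P * P * (4%:R * P) = P ^+ 5 * (3%:R * 4%:R) by ring.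
  rewrite -mulrA => /(padic_dvd_mulXl (K := 5) (N := 1)).
  by apply: padic_dvd_unitMl; rewrite unitrMl ?uP.
have dHv : padic_dvd 1 (H v).
  apply/padic_dvdE; rewrite (adm_congr (N := 1) _ aH hv hw) //; first exact/padic_dvdE.
  by move=> i; have /padic_dvdE -> := hv i; have /padic_dvdE -> := hw i.
rewrite EH //; apply: (@padic_dvdM _ _ 5 1) => //.
have prod_dvd k : padic_dvd k (\prod_(i < k) v i).
  elim: k => [|k IHk]; first by exists (\prod_(i < 0) v i); rewrite mul1r.
  by rewrite big_ord_recr; move: (padic_dvdM IHk (hv k)); rewrite addn1.
exact: prod_dvd.
Qed.
End DefectBound.

(** * The Gamma quotient *)

Section GammaProduct.
Context (p : nat) (p_pr : prime p) (a b : nat).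
Local Notation Zp := (padic_int p_pr).
Hypotheses (p_gt6 : (6 < p)%N) (b_gt0 : (0 < b)%N) (ltba : (b < a)%N)
  (le_p : (2 * a + b <= p.-1)%N).
Local Notation G := (@morita_gamma p p_pr).
Let p_odd : odd p. Proof. exact: prime_gt6_odd p_pr p_gt6. Qed.

Lemma morita_gamma0 : G 0 = 1.
Proof. by have [_ /(_ 0%N)] := morita_gammaP p_pr p_odd; rewrite big_geq // mulr1. Qed.

(** The third difference of log G over -2X, -X, 0, X is compared with its translate by -Y; the value
    at 0 is 1 and drops out. *)
Lemma morita_gamma_fourth_difference X Y : padic_dvd 1 X -> padic_dvd 1 Y ->
  (G (X - Y) * G (- X - Y) ^+ 3 * G (- (2%:R * X))) 5
  = (G X * G (- X) ^+ 3 * (G (- Y) ^+ 3 * G (- (2%:R * X) - Y))) 5.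
Proof.
move=> [xi EX] [eta EY]; rewrite expr1 in EX EY.
(* Translations are available only by integer multiples of p, so Y / p is replaced by a natural
   number; G respects the resulting congruence. *)
pose k := eta 5; have Ek : (p%:R * k%:R : Zp) 5 = Y 5.
  by rewrite EY; apply: padic_congrM => //; rewrite -padic_congr_nat.
have := morita_gamma_third_difference p_gt6 (- (2%:R * xi)) xi k.
have -> : p%:R * (- (2%:R * xi) + xi *+ 3 - k%:R) = X - p%:R * k%:R by rewrite EX; ring.
have -> : p%:R * (- (2%:R * xi) + xi - k%:R) = - X - p%:R * k%:R by rewrite EX; ring.
have -> : p%:R * (- (2%:R * xi) + xi *+ 2 - k%:R) = - (p%:R * k%:R) by ring.
have -> : p%:R * (- (2%:R * xi) - k%:R) = - (2%:R * X) - p%:R * k%:R by rewrite EX; ring.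
have -> : p%:R * (- (2%:R * xi) + xi *+ 3) = X by rewrite EX; ring.
have -> : p%:R * (- (2%:R * xi) + xi) = - X by rewrite EX; ring.
have -> : p%:R * (- (2%:R * xi) + xi *+ 2) = 0 by ring.
have -> : p%:R * (- (2%:R * xi)) = - (2%:R * X) by rewrite EX; ring.
rewrite morita_gamma0 expr1n mul1r.
have EN := padic_congrN Ek.
have GE u : G (u - p%:R * k%:R) 5 = G (u - Y) 5.
  by apply: (morita_gamma_congr p_odd (N := 5)); apply: padic_congrD.
have GN : G (- (p%:R * k%:R)) 5 = G (- Y) 5 by apply: (morita_gamma_congr p_odd (N := 5)).
rewrite (padic_congrM (padic_congrM (GE _) (padic_congrX 3 (GE _))) (erefl _)).
by rewrite (padic_congrM (erefl _) (padic_congrM (padic_congrX 3 GN) (GE _))).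
Qed.

(** Moving each Gamma argument to its part divisible by p leaves the same Pochhammer symbols in both
    summands, and what remains is the preceding congruence. The sum, rather than a difference,
    reflects the minus sign in the theorem. *)
Lemma deform_value_gamma X Y : padic_dvd 1 X -> padic_dvd 1 Y ->
  let al := deform_main a X in let be := deform_beta b Y in
  padic_dvd 5
   ((pochhammer (1 + al) a.-1 * pochhammer (1 - X - Y) (a + b) ^+ 3
       * pochhammer (1 - 2%:R * X) (a + a))
     * (G (1 - be) ^+ 3 * G (1 - al) ^+ 3 * G (1 + al) * G (1 - 2%:R * al - be))
   + (pochhammer (1 + al - be) (a - b).-1 * pochhammer (1 - X) a ^+ 3
       * pochhammer (1 - Y) b ^+ 3 * pochhammer (1 - 2%:R * X - Y) (a + a + b))
     * (G (1 - al - be) ^+ 3 * G (1 - 2%:R * al) * G (1 + al - be))).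
Proof.
move=> dX dY al be.
have dNX := padic_dvdN dX; have dNY := padic_dvdN dY.
have d2X : padic_dvd 1 (- (2%:R * X)) by apply/padic_dvdN/padic_dvdMl.
have up z m := @morita_gamma_up p p_pr p_odd z m.
have down z m := @morita_gamma_down p p_pr p_odd z m.
pose sa : Zp := (-1) ^+ a; pose sb : Zp := (-1) ^+ b.
have E1 : G (1 - be) = - sb * pochhammer (1 - Y) b * G (- Y).
  rewrite (_ : 1 - be = 1 + b%:R + - Y); last by rewrite /be /deform_beta; ring.
  by rewrite up //; [rewrite exprS mulN1r|lia].
have E2 : G (1 - al) = - sa * pochhammer (1 - X) a * G (- X).
  rewrite (_ : 1 - al = 1 + a%:R + - X); last by rewrite /al /deform_main; ring.
  by rewrite up //; [rewrite exprS mulN1r|lia].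
have E3 : G (1 - 2%:R * al - be) = - sb * pochhammer (1 - 2%:R * X - Y) (a + a + b)
    * G (- (2%:R * X) - Y).
  rewrite (_ : 1 - 2%:R * al - be = 1 + (a + a + b)%:R + (- (2%:R * X) - Y)); last first.
    by rewrite !natrD /al /be /deform_main /deform_beta; ring.
  rewrite up //; [|exact: padic_dvdD|lia].
  rewrite exprS !exprD -/sa -/sb.
  rewrite (_ : sa * sa = 1); last by rewrite -expr2 sqrr_sign.
  by rewrite mul1r mulN1r addrA.
have E4 : G (1 - al - be) = - (sa * sb) * pochhammer (1 - X - Y) (a + b) * G (- X - Y).
  rewrite (_ : 1 - al - be = 1 + (a + b)%:R + (- X - Y)); last first.
    by rewrite natrD /al /be /deform_main /deform_beta; ring.
  rewrite up //; [|exact: padic_dvdD|lia].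
  by rewrite exprS exprD mulN1r addrA.
have E5 : G (1 - 2%:R * al) = - pochhammer (1 - 2%:R * X) (a + a) * G (- (2%:R * X)).
  rewrite (_ : 1 - 2%:R * al = 1 + (a + a)%:R + (- (2%:R * X))); last first.
    by rewrite natrD /al /deform_main; ring.
  rewrite up //; last by lia.
  by rewrite exprS exprD -expr2 sqrr_sign mulr1 mulN1r.
have E6 : pochhammer (1 + al) a.-1 * G (1 + al) = - sa * G X.
  rewrite -(down X a.-1) //; last by lia.
  have -> : X - a.-1%:R = 1 + al by rewrite -subn1 natrB; [rewrite /al /deform_main; ring|lia].
  have -> : sa = - (-1) ^+ a.-1.
    by rewrite /sa -[in LHS](@prednK a) ?(leq_ltn_trans _ ltba) // exprS mulN1r.
  set s := (-1) ^+ a.-1; have s2 : s * s = 1 by rewrite -expr2 sqrr_sign.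
  by rewrite opprK -(mulrA s) mulrA s2 mul1r.
have E7 : pochhammer (1 + al - be) (a - b).-1 * G (1 + al - be) = - (sa * sb) * G (X - Y).
  have dXY : padic_dvd 1 (X - Y) by apply: padic_dvdD.
  rewrite -(down (X - Y) (a - b).-1) //; last by lia.
  have -> : X - Y - (a - b).-1%:R = 1 + al - be.
    have -> : ((a - b).-1 = a - b.+1)%N by lia.
    by rewrite natrB // -(natr1 b) /al /be /deform_main /deform_beta; ring.
  have -> : sa * sb = - (-1) ^+ (a - b).-1.
    rewrite /sa /sb -exprD -[LHS]signr_odd -[in RHS]signr_odd oddD -oddB ?(ltnW ltba) //.
    rewrite -[in LHS](@prednK (a - b)) ?subn_gt0 //=.
    by case: (odd _); rewrite ?expr0 ?expr1 ?opprK.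
  set s := (-1) ^+ (a - b).-1; have s2 : s * s = 1 by rewrite -expr2 sqrr_sign.
  by rewrite opprK -(mulrA s) mulrA s2 mul1r.
have /padic_congrP/padic_dvdN := morita_gamma_fourth_difference dX dY.
rewrite E1 E2 E3 E4 E5.
move: (G (- Y)) (G (- X)) (G (- (2%:R * X) - Y)) (G (- X - Y)) (G (- (2%:R * X))) (G X)
  (G (X - Y)) E6 E7 => g1 g2 g3 g4 g5 g6 g7.
move: (pochhammer (1 + al) a.-1) (G (1 + al)) (pochhammer (1 + al - be) (a - b).-1)
  (G (1 + al - be)) => C Ga Z Gab E6 E7 E8.
move: (pochhammer (1 - Y) b) (pochhammer (1 - X) a) (pochhammer (1 - X - Y) (a + b))
  (pochhammer (1 - 2%:R * X) (a + a)) (pochhammer (1 - 2%:R * X - Y) (a + a + b)).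
move=> T Pa U V X4.
rewrite (_ : _ + _ = (U * T * Pa) ^+ 3 * V * X4 *
  ((sa * sb) ^+ 3 * g4 ^+ 3 * g5 * (Z * Gab)
   - sb ^+ 4 * sa ^+ 3 * g1 ^+ 3 * g2 ^+ 3 * g3 * (C * Ga))); last by ring.
apply: padic_dvdMl; rewrite E6 E7.
have sa2 : sa ^+ 2 = 1 by rewrite sqrr_sign.
have sb2 : sb ^+ 2 = 1 by rewrite sqrr_sign.
rewrite (_ : _ - _ = - (sa ^+ 2 * sa ^+ 2 * (sb ^+ 2 * sb ^+ 2)
  * (g7 * g4 ^+ 3 * g5 - g6 * g2 ^+ 3 * (g1 ^+ 3 * g3)))); last by ring.
by rewrite sa2 sb2 !mul1r.
Qed.
End GammaProduct.

Lemma pochhammer_half_ratio (F : fieldType) (A : F) k : (2%:R : F) != 0 -> A != 0 ->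
  pochhammer (A / 2%:R) k != 0 ->
  pochhammer (1 + A / 2%:R) k / pochhammer (A / 2%:R) k = (A + 2%:R * k%:R) / A.
Proof.
move=> two A0 nz; have h0 : A / 2%:R != 0 by rewrite mulf_neq0 ?invr_neq0.
rewrite addrC pochhammer_shift //.
by field; rewrite nz A0.
Qed.

Lemma summand_rearrange (F : fieldType) (A h q1 q2 q3 q4 q5 f w : F) : A != 0 -> h != 0 ->
  A * (q1 ^+ 4 * (w / A * h) * q2 * q3 / (f ^+ 4 * h * q4 * q5))
  = w * (q1 * q1 * q1 * q1 * q2 * q3) / (f * f * f * f * q4 * q5).
Proof.
move=> A0 h0.
transitivity (w * (q1 * q1 * q1 * q1 * q2 * q3) / (f * f * f * f * q4 * q5) * (A / A) * (h / h)).
  by rewrite (_ : f ^+ 4 = f * f * f * f); [rewrite !invfM; ring | ring].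
by rewrite !mulfV ?mulr1.
Qed.

Lemma clear_denominators (R : comUnitRingType) (c x y d g : R) :
  d \is a GRing.unit -> g \is a GRing.unit ->
  d * g * (c * x / d + c * (y / g)) = c * (x * g + d * y).
Proof.
move=> ud ug.
have Ed := mulrV ud; have Eg := mulrV ug; move: (d^-1) (g^-1) Ed Eg => d' g' Ed Eg.
transitivity (c * (x * g * (d * d') + d * y * (g * g'))); first by ring.
by rewrite Ed Eg !mulr1.
Qed.

(** * From the summands in Q_p to the defect and the Gamma quotient *)

Section Assembly.
Context (p : nat) (p_pr : prime p) (a b : nat).
Local Notation Zp := (padic_int p_pr).
Hypotheses (p_gt6 : (6 < p)%N) (b_gt0 : (0 < b)%N) (ltba : (b < a)%N)
  (le_p : (2 * a + b <= p.-1)%N) (ge_p : (p.-1 <= 3 * a + 2 * b)%N).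
Local Notation K := {fraction Zp}.
Local Notation phi := (@FracField.tofrac Zp).

Lemma pochhammer_dvd (x : Zp) k j :
  (j < k)%N -> padic_dvd 1 (x + j%:R) -> padic_dvd 1 (pochhammer x k).
Proof.
by move=> ltj d; rewrite /pochhammer (bigD1 (Ordinal ltj)) //=; apply: padic_dvdMr.
Qed.

Variables (X Y : Zp).
Hypotheses (dX : padic_dvd 1 X) (dY : padic_dvd 1 Y) (X0 : X != 0) (XY : X != Y).

(* The factor (A/2)_k of the summand can vanish only if A = -(a + p), and then
   the k-th numerator is divisible by p^6. *)
Lemma deform_term_dvd i k : X - a%:R = - (2%:R * i%:R) -> (i < k <= 2 * a + b)%N ->
  padic_dvd 6 (deform_term a b X X X X Y k).
Proof.
move=> Ei /andP[ltik lek]; have p0 := prime_gt0 p_pr.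
have EX : X + (2 * i)%:R = a%:R :> Zp.
  by rewrite natrM; move/eqP: Ei; rewrite subr_eq addrC => /eqP ->; ring.
have di : ((2 * i) %% p = a)%N.
  have E : ((2 * i)%:R : Zp) 1%N = (a%:R : Zp) 1%N.
    apply/padic_congrP; rewrite -EX opprD addrCA subrr addr0; exact: padic_dvdN.
  by move: E; rewrite !padic_natr expn1 [in RHS]modn_small //; lia.
have ne : (2 * i != a)%N.
  by apply: contraNneq X0 => E; move/eqP: EX; rewrite E -[X in _ == X]add0r (inj_eq (addIr _)).
have E2i : (2 * i = p + a)%N.
  have := divn_eq (2 * i) p; rewrite di; case: (_ %/ _)%N => [|[|m]]; [lia|lia|].
  by rewrite !mulSn; lia.
have d1 : padic_dvd 1 (pochhammer (X - a%:R) k).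
  by apply: (pochhammer_dvd (j := a)); [lia|rewrite subrK].
have d2 : padic_dvd 1 (pochhammer (deform_beta b Y) k).
  by apply: (pochhammer_dvd (j := b)); [lia|rewrite /deform_beta subrK].
(* The nonunit factor has index p - 1 - a - b. It is reached because twice this index is at most p -
   1 + a, by the lower bound in (ii), while 2k > 2i = p + a. *)
have d3 : padic_dvd 1 (pochhammer (deform_last a b X X X X Y) k).
  apply: (pochhammer_dvd (j := (p.-1 - a - b)%N)); first by lia.
  rewrite (_ : _ + _ = p%:R - X - Y); last first.
    have -> : (p%:R : Zp) = p.-1%:R + 1 by rewrite natr1 (prednK p0).
    rewrite !natrB; try lia.
    by rewrite /deform_last /deform_main /deform_par /deform_beta; ring.
  apply/padic_dvdD/padic_dvdN => //; apply/padic_dvdD/padic_dvdN => //.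
  by exists 1; rewrite mulr1.
rewrite /deform_term; apply/padic_dvdMr/padic_dvdMl.
apply: (@padic_dvdM _ _ 5 1) => //; apply: (@padic_dvdM _ _ 4 1) => //.
apply: (@padic_dvdM _ _ 3 1) => //; apply: (@padic_dvdM _ _ 2 1) => //.
exact: (@padic_dvdM _ _ 1 1).
Qed.

(** The correction p^6 z is needed only when (A/2)_k = 0: the quotient is then 0 by [invr0], and
    [deform_term] is merely divisible by p^6. *)
Lemma frac_summand k : (k <= 2 * a + b)%N ->
  let A : K := phi (deform_main a X) in let B : K := phi (deform_beta b Y) in
  exists z : Zp,
  phi ((X - Y) * deform_main a X) *
  ((pochhammer A k ^+ 4 * pochhammer (1 + A / 2%:R) k
          * pochhammer B k * pochhammer (1 - A - B) k)
       / ((k`!)%:R ^+ 4 * pochhammer (A / 2%:R) k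
          * pochhammer (A - B + 1) k * pochhammer (2%:R * A + B) k))
  = phi (deform_term a b X X X X Y k + p%:R ^+ 6 * z).
Proof.
move=> lek A B.
have two : (2%:R : K) != 0 by apply: (frac_char0 p_pr 1).
have uA : deform_main a X \is a GRing.unit.
  by apply: (@padic_unit_neg _ p_pr _ X a) => //; lia.
have A0 : A != 0 by apply: unit_frac_neq0.
have phiM (x z : Zp) : phi (x * z) = phi x * phi z by apply: rmorphM.
have phiD (x z : Zp) : phi (x + z) = phi x + phi z by apply: rmorphD.
have phiN (x : Zp) : phi (- x) = - phi x by apply: rmorphN.
have [hz|hnz] := eqVneq (pochhammer (A / 2%:R) k) 0.
  have [i /eqP Ei] : exists i : 'I_k, A / 2%:R + i%:R == 0.
    apply/existsP; move/eqP: hz; apply: contraTT => /existsPn h.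
    by apply/prodf_neq0 => i _; apply: h.
  have Ei' : X - a%:R = - (2%:R * i%:R).
    apply/eqP; rewrite -subr_eq0 opprK -tofrac_eq0 phiD -[X - _]/(deform_main a X) -/A.
    have -> : phi (2%:R * i%:R) = 2%:R * i%:R by rewrite phiM !rmorph_nat.
    have -> : A + 2%:R * i%:R = 2%:R * (A / 2%:R + i%:R) by field.
    by rewrite Ei mulr0.
  have [|z Ez] := @deform_term_dvd i k Ei'; first by rewrite ltn_ord.
  exists (- z); rewrite Ez mulrN subrr hz mulr0 !mul0r invr0 !mulr0.
  by apply/esym/rmorph0.
exists 0; rewrite mulr0 addr0 (frac_deform_term b_gt0 ltba le_p dX dX dX dX dY lek XY).
rewrite phiM -mulrA; congr (_ * _); rewrite -/A /dougall_term.
have EA : deform_main a (phi X) = A by rewrite -(frac_deform_main a X).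
have EB : deform_beta b (phi Y) = B by rewrite -(frac_deform_beta b Y).
have EL : deform_last a b (phi X) (phi X) (phi X) (phi X) (phi Y) = 1 - A - B.
  by rewrite /deform_last /deform_par -EA -EB /deform_main; ring.
have EP : deform_par a (phi X) = A by rewrite -EA.
rewrite EL EA EB EP.
have -> : 1 + A - A = 1 by ring.
have -> : 1 + A - B = A - B + 1 by ring.
have -> : 1 + A - (1 - A - B) = 2%:R * A + B by ring.
rewrite -fact_pochhammer.
have E := pochhammer_half_ratio two A0 hnz.
have -> : pochhammer (1 + A / 2%:R) k = (A + 2%:R * k%:R) / A * pochhammer (A / 2%:R) k.
  by rewrite -E mulfVK.
exact: summand_rearrange.
Qed.

Hypotheses (abXY : a%:R * Y = b%:R * X) (XY2 : ~ padic_dvd 2 (X - Y)).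

Lemma frac_sum :
  let A : K := phi (deform_main a X) in let B : K := phi (deform_beta b Y) in
  exists z : Zp,
  phi ((X - Y) * deform_main a X) *
  (\sum_(0 <= k < (2 * a + b).+1) ((pochhammer A k ^+ 4 * pochhammer (1 + A / 2%:R) k
          * pochhammer B k * pochhammer (1 - A - B) k)
       / ((k`!)%:R ^+ 4 * pochhammer (A / 2%:R) k
          * pochhammer (A - B + 1) k * pochhammer (2%:R * A + B) k)))
  = phi (deform_value a b X X X X Y + p%:R ^+ 6 * z).
Proof.
move=> A B; pose v (i : nat) := if i == 4 then Y else X.
have hv : in_polydisc v by move=> i; rewrite /v; case: eqP.
have [z0 Ez0] := deform_defect_fun_dvd p_gt6 b_gt0 ltba le_p ge_p hv.
suff [z Ez] : exists z : Zp,
  phi ((X - Y) * deform_main a X) *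
  (\sum_(0 <= k < (2 * a + b).+1) ((pochhammer A k ^+ 4 * pochhammer (1 + A / 2%:R) k
          * pochhammer B k * pochhammer (1 - A - B) k)
       / ((k`!)%:R ^+ 4 * pochhammer (A / 2%:R) k
          * pochhammer (A - B + 1) k * pochhammer (2%:R * A + B) k)))
  = phi (\sum_(k < (2 * a + b).+1) deform_term a b X X X X Y k + p%:R ^+ 6 * z).
  exists (z0 + z); rewrite Ez; congr phi.
  by rewrite mulrDr -Ez0 /deform_defect_fun /deform_defect /v /= addrA subrKC.
rewrite big_mkord mulr_sumr.
have : forall k : 'I_(2 * a + b).+1, (k <= 2 * a + b)%N by move=> k; rewrite -ltnS.
elim/big_rec2: _ => [_|k x y _ IH le]; first by exists 0; rewrite mulr0 addr0 rmorph0.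
have [z ->] := IH le; have [z' ->] := frac_summand (le k).
exists (z + z'); rewrite -rmorphD; congr phi; ring.
Qed.

(* The relation a Y = b X turns the factor X of deform_value into the factor
   alpha / (alpha - beta) of the Gamma product, times X - Y. *)
Lemma deform_value_congr (Gn Gd : Zp) : Gd \is a GRing.unit ->
  padic_dvd 5
   ((pochhammer (1 + deform_main a X) a.-1 * pochhammer (1 - X - Y) (a + b) ^+ 3
       * pochhammer (1 - 2%:R * X) (a + a)) * Gd
   + (pochhammer (1 + deform_main a X - deform_beta b Y) (a - b).-1 * pochhammer (1 - X) a ^+ 3
       * pochhammer (1 - Y) b ^+ 3 * pochhammer (1 - 2%:R * X - Y) (a + a + b)) * Gn) ->
  padic_dvd 6 (deform_value a b X X X X Y
    + (X - Y) * deform_main a X * (deform_main a X / (deform_main a X - deform_beta b Y) * (Gn / Gd))).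
Proof.
move=> uG d5.
have uAB : deform_main a X - deform_beta b Y \is a GRing.unit.
  apply: (@padic_unit_neg _ p_pr _ (X - Y) (a - b)); [|exact: padic_dvdB|lia].
  by rewrite natrB ?(ltnW ltba) // /deform_main /deform_beta; ring.
have ab0 : (a%:R - b%:R : Zp) != 0.
  by rewrite -natrB ?(ltnW ltba) // padic_natr_eq0 -lt0n subn_gt0.
have EX : (X - Y) * deform_main a X = X * (deform_main a X - deform_beta b Y).
  rewrite /deform_main /deform_beta.
  transitivity ((X - Y) * X - a%:R * X + a%:R * Y); first by ring.
  by rewrite abXY; ring.
rewrite EX mulrA -(mulrA X) (mulrCA _ (deform_main a X)) mulrV // mulr1.
rewrite /deform_value.
have -> : 1 + X - X - X - Y = 1 - X - Y by ring.
have -> : 1 + X - X - X - X = 1 - 2%:R * X by ring.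
have -> : 1 + X - X - X = 1 - X by ring.
have -> : 1 + X - X = 1 by ring.
have u1 : pochhammer (1 + deform_main a X - deform_beta b Y) (a - b).-1 \is a GRing.unit.
  exact: (deform_value_den_unit b_gt0 ltba le_p dX dY).
have pu (z : Zp) k : padic_dvd 1 z -> (k <= 2 * a + b)%N -> pochhammer (1 + z) k \is a GRing.unit.
  exact: poch_1z_unit.
have u2 : pochhammer (1 - X) a \is a GRing.unit by apply: pu; [exact: padic_dvdN|lia].
have u3 : pochhammer (1 - Y) b \is a GRing.unit by apply: pu; [exact: padic_dvdN|lia].
have u4 : pochhammer (1 - 2%:R * X - Y) (a + a + b) \is a GRing.unit.
  rewrite -addrA; apply: pu; last by lia.
  by apply: padic_dvdB => //; apply/padic_dvdN/padic_dvdMl.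
move: d5 u1 u2 u3 u4.
set N1 := pochhammer (1 + deform_main a X) a.-1; set N2 := pochhammer (1 - X - Y) _.
set N3 := pochhammer (1 - 2%:R * X) _.
set D1 := pochhammer _ _; set D2 := pochhammer _ _; set D3 := pochhammer _ _.
set D4 := pochhammer _ _ => d5 u1 u2 u3 u4.
have uD : D1 * D2 ^+ 3 * D3 ^+ 3 * D4 \is a GRing.unit by rewrite !unitrMl ?unitrX.
apply: (@padic_dvd_unitMl _ _ _ ((D1 * D2 ^+ 3 * D3 ^+ 3 * D4) * Gd)).
  by rewrite unitrMl.
have -> : D1 * (D2 * D2 * D2) * (D3 * D3 * D3) * D4 = D1 * D2 ^+ 3 * D3 ^+ 3 * D4 by ring.
set DD := D1 * D2 ^+ 3 * D3 ^+ 3 * D4 in d5 uD *.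
set NN := N1 * N2 ^+ 3 * N3 in d5.
have -> : N1 * (N2 * N2 * N2) * N3 = NN by rewrite /NN; ring.
rewrite [X * deform_main a X]mulrC clear_denominators //.
apply: (@padic_dvdM _ _ 1 5) => //.
exact: padic_dvdMl.
Qed.
End Assembly.

Theorem theorem8p2 (p : nat) (p_pr : prime p) (p_ge3 : (3 <= p)%N)
  (alpha beta : 'Z_[p_pr]) :
  let a := padic_residue (- alpha) in
  let b := padic_residue (- beta) in
  let A : 'Q_[p_pr] := alpha%:F in
  let B : 'Q_[p_pr] := beta%:F in
  let G : 'Z_[p_pr] -> 'Z_[p_pr] := @morita_gamma p p_pr in
  let M := (2 * a + b)%N in
  (b < a)%N ->
  (2 * a + b <= p - 1)%N /\ (p - 1 <= 3 * a + 2 * b)%N ->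
  a%:R / A = b%:R / B ->
  ~ padic_dvd 2 (pochhammer (alpha - beta + 1) (p - 1)) ->
  padic_eqmod 5
    (\sum_(0 <= k < M.+1)
       (pochhammer A k ^+ 4 * pochhammer (1 + A / 2%:R) k
          * pochhammer B k * pochhammer (1 - A - B) k)
       / ((k`!)%:R ^+ 4 * pochhammer (A / 2%:R) k
          * pochhammer (A - B + 1) k * pochhammer (2%:R * A + B) k))
    (- (A / (A - B)) *
       ((G (1 - alpha - beta) ^+ 3 * G (1 - 2%:R * alpha)
                     * G (1 + alpha - beta))%:F
        / (G (1 - beta) ^+ 3 * G (1 - alpha) ^+ 3
                     * G (1 + alpha) * G (1 - 2%:R * alpha - beta))%:F)).
Proof.
move=> a b A B G M ltba [le_p ge_p] abAB iv.
rewrite !subn1 in le_p ge_p iv.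
have p0 := prime_gt0 p_pr.
have a_gt0 : (0 < a)%N by apply: leq_ltn_trans ltba.
have char0 := frac_char0 p_pr.
have natK0 m : (0 < m)%N -> (m%:R : 'Q_[p_pr]) != 0 by case: m => // m _; apply: char0.
have residue0 (x : 'Z_[p_pr]) : padic_residue (- x) != 0%N -> x != 0.
  by apply: contraNneq => ->; rewrite oppr0 /padic_residue padic_comp0.
have al0 : alpha != 0 by apply: residue0; rewrite -lt0n.
have A0 : A != 0 by rewrite tofrac_eq0.
(* As a > 0, the left side of (iii) is nonzero, which forces both b > 0 and beta nonzero. *)
have bB0 : b%:R / B != 0 by rewrite -abAB mulf_neq0 ?invr_eq0 ?natK0.
have b_gt0 : (0 < b)%N by rewrite lt0n; apply: contraNneq bB0 => ->; rewrite mul0r.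
have B0 : B != 0 by apply: contraNneq bB0 => ->; rewrite invr0 mulr0.
(* From a >= 2 and b >= 1 follows p - 1 >= 5, and 6 is not prime. *)
have p_gt6 : (6 < p)%N.
  have : (5 < p)%N by lia.
  by rewrite leq_eqVlt => /orP[/eqP E|//]; have : prime p by []; rewrite -E.
have phiM (x z : 'Z_[p_pr]) : (x * z)%:F = x%:F * z%:F by apply: rmorphM.
have phiD (x z : 'Z_[p_pr]) : (x + z)%:F = x%:F + z%:F by apply: rmorphD.
have phiN (x : 'Z_[p_pr]) : (- x)%:F = - x%:F by apply: rmorphN.
have phi_nat m : (m%:R : 'Z_[p_pr])%:F = m%:R by apply: rmorph_nat.
pose X := alpha + a%:R; pose Y := beta + b%:R.
have residue_dvd (x : 'Z_[p_pr]) : padic_dvd 1 (x + (padic_residue (- x))%:R).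
  rewrite -[X in _ + X]opprK; apply/padic_congrP.
  rewrite -[x in LHS]opprK; apply: padic_congrN.
  by rewrite [LHS]padic_congr_nat.
have dX : padic_dvd 1 X by apply: residue_dvd.
have dY : padic_dvd 1 Y by apply: residue_dvd.
have EX : deform_main a X = alpha by rewrite /deform_main addrK.
have EY : deform_beta b Y = beta by rewrite /deform_beta addrK.
have abXY : a%:R * Y = b%:R * X.
  rewrite /X /Y !mulrDr [a%:R * b%:R]mulrC; congr (_ + _).
  apply/eqP; rewrite -subr_eq0 -tofrac_eq0 phiD phiN !phiM !phi_nat subr_eq0.
  by move/eqP: abAB; rewrite (eqr_div _ _ A0 B0).
(* X - Y is the factor of index a - b - 1 of (alpha - beta + 1)_(p-1), so (iv) limits it to a single
   p. *)
have XY2 : ~ padic_dvd 2 (X - Y).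
  move=> d; apply: iv; have ltm : ((a - b).-1 < p.-1)%N by lia.
  rewrite /pochhammer (bigD1 (Ordinal ltm)) //=; apply: padic_dvdMr.
  rewrite (_ : alpha - beta + 1 + (a - b).-1%:R = X - Y) //.
  have -> : ((a - b).-1 = a - b.+1)%N by lia.
  by rewrite natrB // -(natr1 b) /X /Y; ring.
have XY : X != Y.
  by apply/eqP => E; apply: XY2; rewrite E subrr; apply: padic_dvd0.
have X0 : X != 0.
  apply: contra_neq XY => E; move/eqP: abXY; rewrite E mulr0 mulf_eq0 padic_natr_eq0.
  by rewrite gtn_eqF //= => /eqP ->.
have [z Ez] := frac_sum p_gt6 b_gt0 ltba le_p ge_p dX dY X0 XY.
rewrite EX EY in Ez.
have uG x : G x \is a GRing.unit := morita_gamma_unit (prime_gt6_odd p_pr p_gt6) x.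
set Gn := G _ ^+ 3 * _ * _; set Gd := G _ ^+ 3 * _ * _ * _.
have uGd : Gd \is a GRing.unit by rewrite !unitrMl ?unitrX ?uG.
have dG := deform_value_gamma p_gt6 b_gt0 ltba le_p dX dY; rewrite /= EX EY in dG.
have := deform_value_congr p_gt6 b_gt0 ltba le_p ge_p dX dY X0 XY abXY uGd (Gn := Gn).
rewrite EX EY => /(_ dG); set Rz := _ * (Gn / Gd) => -[t Et].
have uAB : alpha - beta \is a GRing.unit.
  apply: (@padic_unit_neg _ p_pr _ (X - Y) (a - b)); [|exact: padic_dvdB|lia].
  by rewrite natrB ?(ltnW ltba) // /X /Y; ring.
have phiV (x : 'Z_[p_pr]) : x \is a GRing.unit -> (x^-1)%:F = x%:F^-1.
  by move=> ux; apply: rmorphV.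
have ERz : A / (A - B) * (Gn%:F / Gd%:F) = Rz%:F.
  rewrite [RHS]phiM; congr (_ * _); rewrite [RHS]phiM; congr (_ * _).
    by rewrite (phiV _ uAB) phiD phiN.
  by rewrite (phiV _ uGd).
have [w Ew] : padic_dvd 1 (X - Y) by apply: padic_dvdB.
rewrite expr1 in Ew.
have uw : w \is a GRing.unit.
  apply: contra_notT XY2 => /padic_dvd_nonunit[w' Ew'].
  by exists w'; rewrite Ew Ew' expr1 expr2 mulrA.
have ual : alpha \is a GRing.unit.
  rewrite -EX; apply: (@padic_unit_neg _ p_pr _ X a); [exact: erefl|exact: dX|lia].
(* Everything so far holds modulo p^6 after multiplication by (X - Y) alpha = p w alpha; dividing by
   it loses one p, since [w] and [alpha] are units. *)
exists ((w * alpha)^-1 * (t + z)); rewrite mulNr opprK ERz.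
have nz : ((X - Y) * alpha)%:F != 0 by rewrite tofrac_eq0 mulf_neq0 ?subr_eq0.
apply: (mulfI nz); rewrite mulrDr Ez -!phiM -phiD; congr (_%:F).
transitivity (deform_value a b X X X X Y + (X - Y) * alpha * Rz + p%:R ^+ 6 * z); first by ring.
rewrite Et -mulrDr Ew.
transitivity (p%:R ^+ 6 * (w * alpha * (w * alpha)^-1) * (t + z)); last by ring.
by rewrite mulrV ?mulr1 // unitrMl.
Qed.
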